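(* Let $G$ be a locally compact Abelian group with dual group $\widehat G$ and Haar measure $\mu$, and assume $\mu(G)<\infty$. Let $1<p<\infty$ and $\theta\ge0$, and let $[L^p(G)]_{L^{p),\theta}}$ denote the closure of $C_c(G)$ in the generalized grand Lebesgue space $L^{p),\theta}(G)$. Then a closed set $E\subset\widehat G$ is a Ditkin set for $[L^p(G)]_{L^{p),\theta}}$ if and only if $E$ is a Ditkin set for $L^1(G)$.
   Context: $C_c(G)$ is the space of continuous complex-valued functions on $G$ with compact support. The generalized grand Lebesgue space $L^{p),\theta}(G)$ consists of measurable $f$ on $G$ with $\|f\|_{p),\theta}=\sup_{0<\varepsilon\le p-1}\varepsilon^{\theta/(p-\varepsilon)}\left(\int_G|f|^{p-\varepsilon}\,d\mu\right)^{1/(p-\varepsilon)}<\infty$; it is a Banach space, and $[L^p(G)]_{L^{p),\theta}}$ carries the norm $\|\cdot\|_{p),\theta}$. For a Banach space $X\subset L^1(G)$ which is a Banach ideal in $L^1(G)$ under convolution (continuously embedded in $L^1(G)$ with $g*f\in X$ for $g\in L^1(G)$, $f\in X$), a closed set $E\subset\widehat G$ is a Ditkin set for $X$ if for every $f\in X$ whose Fourier transform $\hat f$ vanishes on $E$ and every $\varepsilon>0$ there is $F\in X$ such that $\hat F$ vanishes on some neighbourhood of $E$ and $\|f-f*F\|_X<\varepsilon$ (with $X=L^1(G)$ this defines Ditkin sets for $L^1(G)$). *)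

(* Defs.v *)
From HB Require Import structures.
From mathcomp Require Import all_boot all_algebra.
From mathcomp Require Import all_classical all_reals all_analysis.
From mathcomp Require Import complex.
Import GRing.Theory Num.Theory numFieldNormedType.Exports.

Set Implicit Arguments.
Unset Strict Implicit.
Unset Printing Implicit Defensive.

Local Open Scope classical_set_scope.
Local Open Scope ring_scope.
Local Open Scope complex_scope.

Definition gpt (G : topologicalZmodType) : Type := G.
HB.instance Definition _ (G : topologicalZmodType) :=
  Choice.copy (gpt G) G.
HB.instance Definition _ (G : topologicalZmodType) :=
  isPointed.Build (gpt G) (0 : G).
Definition openG (G : topologicalZmodType) : set (set (gpt G)) := @open G.
Notation borelG G := (@g_sigma_algebraType (gpt G) (@openG G)).

Definition cabs (R : realType) (z : R[i]) : R :=
  Num.sqrt (complex.Re z ^+ 2 + complex.Im z ^+ 2).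

Section lca.
Variables (R : realType) (G : topologicalZmodType).
Local Notation BG := (borelG G).
Variable mu : {measure set BG -> \bar R}.

Definition haar_measure : Prop :=
  [/\ (0 < mu setT)%E,
      (forall (a : G) (A : set BG), measurable A ->
          mu ((fun x : G => x + a) @` A) = mu A),
      (forall K : set G, compact K -> (mu K < +oo)%E),
      (forall A : set BG, measurable A ->
          mu A = ereal_inf [set mu U | U in [set U : set G | open U /\ A `<=` U]]) &
      (forall U : set G, open U ->
          mu U = ereal_sup [set mu K | K in [set K : set G | compact K /\ K `<=` U]])].

Definition cmeasurable (f : G -> R[i]) : Prop :=
  measurable_fun setT (fun x : BG => complex.Re (f x)) /\
  measurable_fun setT (fun x : BG => complex.Im (f x)).

Definition cintegral (f : G -> R[i]) : R[i] :=
  Complex (Rintegral mu setT (fun x : BG => complex.Re (f x)))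
          (Rintegral mu setT (fun x : BG => complex.Im (f x))).

Definition conv (f g : G -> R[i]) : G -> R[i] :=
  fun x => cintegral (fun y => f y * g (x - y)).

Definition L1norm (f : G -> R[i]) : \bar R :=
  (\int[mu]_(x in [set: BG]) (cabs (f x))%:E)%E.
Definition L1 (f : G -> R[i]) : Prop := cmeasurable f /\ (L1norm f < +oo)%E.

Definition grand_norm (p theta : R) (f : G -> R[i]) : \bar R :=
  ereal_sup [set ((eps `^ (theta / (p - eps)))%:E *
                  ((\int[mu]_(x in [set: BG]) (cabs (f x) `^ (p - eps))%:E)
                     `^ (1 / (p - eps))))%E
            | eps in `]0, p - 1]].
Definition grandL (p theta : R) (f : G -> R[i]) : Prop :=
  cmeasurable f /\ (grand_norm p theta f < +oo)%E.

Definition Cc (f : G -> R[i]) : Prop :=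
  continuous (fun x => complex.Re (f x)) /\ continuous (fun x => complex.Im (f x)) /\
  compact (closure [set x | f x != 0]).

Definition grandLp_closure (p theta : R) (f : G -> R[i]) : Prop :=
  grandL p theta f /\
  forall d : R, 0 < d -> exists g, Cc g /\ (grand_norm p theta (f \- g)%R < d%:E)%E.

Definition character (g : G -> R[i]) : Prop :=
  [/\ continuous (fun x => complex.Re (g x)), continuous (fun x => complex.Im (g x)),
      (forall x y, g (x + y) = g x * g y) & (forall x, cabs (g x) = 1)].
Definition dual : set (G -> R[i]) := [set g | character g].

Definition dual_nbhs (g0 : G -> R[i]) (U : set (G -> R[i])) : Prop :=
  exists (K : set G) (e : R), [/\ compact K, 0 < e &
    [set g | dual g /\ forall x, K x -> cabs (g x - g0 x) < e] `<=` U].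
Definition dual_open (U : set (G -> R[i])) : Prop :=
  U `<=` dual /\ forall g, U g -> dual_nbhs g U.
Definition dual_closed (E : set (G -> R[i])) : Prop :=
  E `<=` dual /\ dual_open (dual `\` E).

Definition fourier (f : G -> R[i]) (g : G -> R[i]) : R[i] :=
  cintegral (fun x => f x * g (- x)).

Definition ditkin (X : (G -> R[i]) -> Prop) (nX : (G -> R[i]) -> \bar R)
    (E : set (G -> R[i])) : Prop :=
  forall f, X f -> (forall g, E g -> fourier f g = 0) ->
  forall e : R, 0 < e ->
  exists F, [/\ X F,
    (exists O, [/\ dual_open O, E `<=` O & forall g, O g -> fourier F g = 0]) &
    (nX (f \- conv f F)%R < e%:E)%E].

End lca.

(* Main.v *)
(* Since [mu] is finite, inner regularity makes [G] compact, so continuous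
   functions are integrable and E being a Ditkin set can be transferred between
   the two norms by smoothing. Let [e], [e'] be continuous probability densities
   concentrated near 0.
   - If F is a Ditkin approximation of the continuous function f * e in the grand
     norm, then F * e is one of f in L^1, because
     f - f*(F*e) = (f - f*e) + (f*e - (f*e)*F) and the grand norm dominates the
     L^1 norm.
   - If F is a Ditkin approximation of f * e in L^1, then (F * e) * e' is one of f
     in the grand norm, because f - f*((F*e)*e') =
     (f - f*e) + (f*e - (f*e)*e') + (f*e - (f*e)*F)*e' and convolution with e' maps
     L^1 into the bounded functions.
   Multiplication by the Fourier transforms of e and e' keeps the zeros of the
   transform of F. Borel sets of G * G need not be product-measurable, so Fubini's
   theorem is only used for integrands f(x) g(y) h(x, y) with h continuous. *)
Require Import Defs.
From HB Require Import structures.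
From mathcomp Require Import all_boot all_order all_algebra finmap.
From mathcomp Require Import all_classical all_reals all_analysis.
From mathcomp Require Import measurable_realfun complex ring.
Import GRing.Theory Num.Theory numFieldNormedType.Exports.
Import Order.TTheory.
Local Open Scope classical_set_scope.
Local Open Scope ring_scope.

Set Implicit Arguments.
Unset Strict Implicit.
Unset Printing Implicit Defensive.

(** * Continuous functions on a compact topological group *)

(** [compact_cover] speaks of pointed spaces: a nonempty [A] supplies the point, and the empty set
    has the empty subcover. *)
Lemma compact_finite_cover (T : topologicalType) (A : set T) :
  compact A -> cover_compact A.
Proof.
move=> cA; have [A0|/set0P[a Aa]] := eqVneq A set0.
  by move=> I D f _ _; exists fset0; rewrite ?A0 // => x; rewrite in_fset0.
pose pT : ptopologicalType := HB.pack T (Topological.on T) (isPointed.Build T a).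
have cA' : compact (A : set pT) by [].
by rewrite compact_cover in cA'.
Qed.

Lemma open_rectangle (T U : topologicalType) (A : set T) (B : set U) :
  open A -> open B -> open (A `*` B).
Proof.
move=> oA oB; rewrite openE => -[a b] /= [Aa Bb].
by exists (A, B); [split; exact: open_nbhs_nbhs|].
Qed.

Section Borel.
Variables (R : realType) (G : topologicalZmodType).
Local Notation BG := (borelG G).

Lemma open_borel (U : set G) : open U -> measurable (U : set BG).
Proof. by move=> oU; apply: sub_sigma_algebra. Qed.

Lemma closed_borel (C : set G) : closed C -> measurable (C : set BG).
Proof.
move=> /closed_openC oC; rewrite -(setCK C); apply: measurableC.
exact: open_borel.
Qed.

Lemma continuous_borel (f : G -> R) :
  continuous f -> measurable_fun [set: BG] (f : BG -> R).
Proof.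
move=> /continuousP cf; apply: (measurability _ (RGenOpens.measurableE R)).
move=> _ [_ [a [b ->] <-]]; rewrite setTI; apply: open_borel.
exact/cf/interval_open.
Qed.

Lemma continuous_borel_self (f : G -> G) :
  continuous f -> measurable_fun [set: BG] (f : BG -> BG).
Proof.
move=> /continuousP cf; apply: (@measurability _ _ BG BG setT f (@openG G) erefl).
by move=> _ [U oU <-]; rewrite setTI; apply: open_borel; apply: cf.
Qed.

Lemma addr_continuous_G (a : G) : continuous (fun x : G => x + a).
Proof.
move=> x; apply: (@continuous_comp _ _ _ (fun x : G => (x, a)) (fun z => z.1 + z.2)).
  by apply: cvg_pair => /=; [exact: cvg_id|exact: cvg_cst].
exact: add_continuous.
Qed.

Lemma subl_continuous_G (a : G) : continuous (fun x : G => a - x).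
Proof.
move=> x; apply: (@continuous_comp _ _ _ (fun x : G => (a, x)) (fun z => z.1 - z.2)).
  by apply: cvg_pair => /=; [exact: cvg_cst|exact: cvg_id].
exact: sub_continuous.
Qed.

Hypothesis cG : compact [set: G].

(* An open set {k > a} is only a countable union of compact sets
   {k >= a + 1/(n+1)}, and each of these is covered by finitely many open
   rectangles inside {k > a}. *)
Lemma continuous_prod_measurable (k : G * G -> R) :
  continuous k -> measurable_fun [set: BG * BG] (k : BG * BG -> R).
Proof.
move=> ck; apply: (measurability _ (RGenOInfty.measurableE R)).
move=> _ [_ [a ->] <-]; rewrite setTI.
have cGG : compact [set: G * G] by rewrite -setXTT; exact: compact_setX.
pose W := [set z : G * G | a < k z].
pose C n := [set z : G * G | a + n.+1%:R^-1 <= k z].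
have oW : open W.
  rewrite (_ : W = k @^-1` [set x | x > a]) //.
  by apply: open_comp => // *; exact: ck.
have cC n : compact (C n).
  apply: (subclosed_compact _ cGG) => //.
  rewrite (_ : C n = k @^-1` [set x | a + n.+1%:R^-1 <= x]) //.
  by apply: closed_comp => // *; exact: ck.
(* Outside [W] the pair is the dummy [(set0, set0)], so that [choice] yields a total function. *)
have rect z : exists UV : set G * set G, W z ->
    [/\ open UV.1, open UV.2, UV.1 z.1, UV.2 z.2 & UV.1 `*` UV.2 `<=` W].
  have [Wz|] := pselect (W z); last by exists (set0, set0).
  have : nbhs z W by exact: open_nbhs_nbhs.
  case=> -[A B] /= [nA nB] AB; exists (interior A, interior B) => _; split => //=.
  - exact: open_interior.
  - exact: open_interior.
  - move=> [u v] /= [Au Bv]; apply: AB; split; exact: interior_subset.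
have [r rP] := choice rect.
have CW n : C n `<=` W.
  by move=> z; apply: lt_le_trans; rewrite ltrDl invr_gt0 ltr0Sn.
have fc n : exists D : {fset (G * G)}, (forall z, z \in D -> W z) /\
    C n `<=` \bigcup_(z in [set` D]) ((r z).1 `*` (r z).2).
  have [] := @compact_finite_cover _ _ (cC n) _ (C n)
      (fun z => (r z).1 `*` (r z).2).
  - move=> z /CW /rP[? ? _ _ _]; exact: open_rectangle.
  - by move=> z Cz; exists z => //; have [] := rP z (CW _ _ Cz).
  - move=> D DC Dc; exists D; split => // z zD; apply: (CW n).
    exact: set_mem (DC z zD).
have [D DP] := choice fc.
rewrite (_ : _ @^-1` _ =
    \bigcup_n \bigcup_(z in [set` D n]) ((r z).1 `*` (r z).2)); last first.
  apply/seteqP; split => z /=.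
  - rewrite in_itv /= andbT => az.
    have kz : 0 < k z - a by rewrite subr_gt0.
    have [n _] := near_infty_natSinv_lt (PosNum kz).
    move=> /(_ n (leqnn n)) /= nP; exists n => //; apply: (DP n).2.
    by rewrite /C /= -lerBrDl ltW.
  - move=> [n _ [y yD yz]]; rewrite in_itv /= andbT.
    have Wy := (DP n).1 y yD.
    by have [_ _ _ _ ] := rP y Wy; exact.
apply: bigcup_measurable => n _; apply: fin_bigcup_measurable => // z zD.
have [op1 op2 _ _ _] := rP z ((DP n).1 z zD).
by apply: measurableX; exact: open_borel.
Qed.

(** Uniform continuity in translation form. The near-covering form of compactness leaves only a
    neighbourhood of each pair (x, 0) to treat, and there f(x + u) and f(x) have the same limit. *)
Lemma continuous_uniform (f : G -> R) (e : R) : continuous f -> 0 < e ->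
  \forall u \near (0 : G), forall x, `|f (x + u) - f x| < e.
Proof.
move=> cf e0.
have := (compact_near_coveringP [set: G]).1 cG G (nbhs (0 : G))
   (fun u x => `|f (x + u) - f x| < e) _.
move=> H; near=> u => x; suff : [set: G] `<=` (fun x => `|f (x + u) - f x| < e) by exact.
near: u; apply: H => x _.
have c1 : (fun z : G * G => f (z.1 + z.2)) @ (x, 0) --> f x.
  apply: (@cvg_comp _ _ _ (fun z : G * G => z.1 + z.2) f _ (nbhs (x + 0))).
    exact: (@add_continuous G (x, 0)).
  by rewrite addr0; exact: cf.
have c2 : (fun z : G * G => f z.1) @ (x, (0:G)) --> f x.
  by apply: (@cvg_comp _ _ _ (fun z : G * G => z.1) f _ (nbhs x)); [exact: cvg_fst|exact: cf].
have := cvgB c1 c2; rewrite subrr => c3; exact: (cvgr0_norm_lt _ (c3 (nbhs_filter _)) _ e0).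
Unshelve. all: by end_near. Qed.

Lemma continuous_bounded (f : G -> R) : continuous f ->
  exists M, forall x, `|f x| <= M.
Proof.
move=> cf; have : compact (f @` [set: G]).
  apply: continuous_compact => //; exact: continuous_subspaceT.
move=> /compact_bounded [M [_ MP]]; exists (M + 1) => x.
by apply: (MP (M + 1)); [rewrite ltrDl|exists x].
Qed.

End Borel.

(** * Haar measure *)

(** Serves to carry measurability and nullity together through a finite union. *)
Lemma bigcup_fset_ind (T : Type) (I : choiceType) (D : {fset I}) (f : I -> set T) (P : set T -> Prop) :
  P set0 -> (forall A B, P A -> P B -> P (A `|` B)) -> (forall i, P (f i)) ->
  P (\bigcup_(i in [set` D]) f i).
Proof. by move=> P0 PU Pf; rewrite bigcup_fset; apply: big_ind. Qed.

Section Haar.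
Variables (R : realType) (G : topologicalZmodType).
Local Notation BG := (borelG G).
Variable mu : {finite_measure set BG -> \bar R}.
Hypotheses (HG : hausdorff_space G) (Hmu : haar_measure mu).

Let mu0 : (0 < mu setT)%E. Proof. by case: Hmu. Qed.

Let mufin (A : set BG) : measurable A -> mu A \is a fin_num.
Proof. by move=> mA; exact: fin_num_measure. Qed.

Lemma compact_borel (K : set G) : compact K -> measurable (K : set BG).
Proof. by move=> cK; apply: closed_borel; exact: compact_closed. Qed.

Definition mu_preserving (T : BG -> BG) :=
  measurable_fun setT T /\ forall A, measurable A -> mu (T @^-1` A) = mu A.

(** [haar_measure] speaks of images, so the preimage under translation by [a] is rewritten as the
    image under translation by [- a]. *)
Lemma addr_preserving (a : G) : mu_preserving (fun x : BG => (x : G) + a).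
Proof.
split; first by apply: continuous_borel_self; exact: addr_continuous_G.
move=> A mA; case: Hmu => _ /(_ (- a) A mA) <- _ _ _; congr (mu _).
apply/seteqP; split => [x /= Ax|_ [x Ax <-]] /=.
  by exists (x + a) => //; rewrite addrK.
by rewrite subrK.
Qed.

(* By inner regularity some compact K has more than half of the total mass, so
   K meets each of its translates, that is, K - K is the whole group. *)
Lemma haar_compact : compact [set: G].
Proof.
have mTf := mufin measurableT.
have [K cK muK] : exists2 K : set G, compact K & ((fine (mu setT) / 2)%:E < mu K)%E.
  have [_ _ _ _ /(_ setT openT)] := Hmu => muT.
  have : ((fine (mu setT) / 2)%:E < mu setT)%E.
    rewrite -[ltRHS]fineK// lte_fin ltr_pdivrMr// ltr_pMr ?ltr1n//.
    by rewrite -lte_fin fineK.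
  rewrite {2}muT => /ereal_sup_gt[_ [K [cK _] <-] ?]; by exists K.
have mK := compact_borel cK.
have KK : (fun z : G * G => z.1 - z.2) @` (K `*` K) = [set: G].
  apply/seteqP; split => // x _; apply: contrapT => nx.
  pose Kx : set BG := (fun y : G => y + - x) @^-1` K.
  have mKx : measurable Kx.
    by rewrite -[Kx]setTI; apply: (addr_preserving (- x)).1.
  have KxE : mu Kx = mu K by apply: (addr_preserving (- x)).2.
  have dK : [disjoint (K : set BG) & Kx].
    apply/disj_setPS => y [Ky Kyx]; apply: nx.
    by exists (y, y - x) => //=; rewrite opprB addrC subrK.
  have : (mu (K `|` Kx) <= mu setT)%E.
    apply: le_measure => //; rewrite inE; [exact: (measurableU _ _ mK mKx)|exact: measurableT].
  rewrite (_ : mu _ = mu K + mu K)%E; last first.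
    rewrite measureU//; first by congr (_ + _)%E; exact: KxE.
    exact/disj_set2P.
  rewrite leNgt => /negP; apply.
  rewrite -(fineK (mufin mK)) -(fineK mTf) -EFinD lte_fin.
  move: muK; rewrite -(fineK (mufin mK)) lte_fin => muK.
  by rewrite [ltLHS]splitr ltrD.
rewrite -KK; apply: continuous_compact; last exact: compact_setX.
by apply: continuous_subspaceT; exact: sub_continuous.
Qed.
Let cG := haar_compact.

(** Finitely many translates of [U] cover the compact group; if [U] were null, the whole group would
    be null. *)
Lemma haar_open_gt0 (U : set G) (x0 : G) : open U -> U x0 -> (0 < mu U)%E.
Proof.
move=> oU Ux0; rewrite lt_neqAle measure_ge0 andbT; apply/negP => /eqP U0.
pose f (y : G) := (fun x : G => x + y) @^-1` U.
have [] := @compact_finite_cover _ _ cG _ setT f.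
- by move=> y _; apply: open_comp => // x _; exact: (@addr_continuous_G G y).
- by move=> x _; exists (x0 - x) => //; rewrite /f /= addrC subrK.
move=> D _ cD; move: mu0; rewrite (_ : setT = \bigcup_(y in [set` D]) f y); last first.
  by apply/seteqP; split => // x _; exact: cD.
suff [_ ->] : measurable ((\bigcup_(y in [set` D]) f y) : set BG) /\
    mu (\bigcup_(y in [set` D]) f y) = 0%E by rewrite ltxx.
apply: (@bigcup_fset_ind _ _ D f (fun A : set BG => measurable A /\ mu A = 0%E)).
- by rewrite measure0.
- by move=> A B [mA A0] [mB B0]; split; [exact: measurableU|rewrite measureU0].
- move=> y; have [mT pT] := addr_preserving y; have mU := open_borel oU.
  split; last by rewrite [RHS]U0; apply: pT.
  by rewrite -[f y]setTI; exact: mT.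
Qed.

(** A compact Hausdorff space is normal, so Urysohn's lemma separates [C] from the complement of
    [U]. *)
Lemma urysohn_G (C U : set G) : closed C -> open U -> C `<=` U ->
  exists f : G -> R, [/\ continuous f, (forall x, 0 <= f x <= 1),
    (forall x, C x -> f x = 1) & (forall x, ~ U x -> f x = 0)].
Proof.
move=> clC oU CU.
have nG : normal_space G by exact: compact_normal.
have us : uniform_separator (~` U) C.
  apply: ((@normal_separatorP R G).1 nG) => //; first exact: open_closedC.
  by apply/seteqP; split => // x [/= nUx /CU].
exists (Urysohn (~` U) C); split.
- exact: Urysohn_continuous.
- move=> x; have := @Urysohn_range _ R (~` U) C (Urysohn (~` U) C x).
  by rewrite /= in_itv /=; apply; exists x.
- by move=> x Cx; have := @Urysohn_sub1 _ R _ _ us; apply; exists x.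
- by move=> x Ux; have := @Urysohn_sub0 _ R _ _ us; apply; exists x.
Qed.

(** The pushforward of [mu] by [T] agrees with [mu] on measurable sets. *)
Lemma mu_preserving_ge0_integral T (f : BG -> \bar R) : mu_preserving T ->
  measurable_fun setT f -> (forall x, 0 <= f x)%E ->
  (\int[mu]_x f (T x) = \int[mu]_x f x)%E.
Proof.
move=> [mT pT] mf f0.
rewrite -[LHS](@ge0_integral_pushforward _ _ _ _ _ T mT mu setT f) ?preimage_setT//.
by apply: eq_measure_integral => A mA _; exact: pT.
Qed.

Lemma mu_preserving_integral T (f : BG -> \bar R) : mu_preserving T ->
  measurable_fun setT f -> (\int[mu]_x f (T x) = \int[mu]_x f x)%E.
Proof.
move=> pT mf; rewrite [LHS]integralE [RHS]integralE; congr (_ - _)%E.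
- have -> := funepos_comp f T; apply: (mu_preserving_ge0_integral pT) => //.
  exact: measurable_funepos.
- have -> := funeneg_comp f T; apply: (mu_preserving_ge0_integral pT) => //.
  exact: measurable_funeneg.
Qed.

Lemma mu_preserving_integrable T (f : BG -> \bar R) : mu_preserving T ->
  mu.-integrable setT f -> mu.-integrable setT (f \o T).
Proof.
move=> pT /integrableP[mf fi]; apply/integrableP; split.
  by apply: measurableT_comp => //; case: pT.
have /= := @mu_preserving_ge0_integral T (abse \o f) pT; move=> ->//.
exact: measurableT_comp.
Qed.

(* Integrate f (x - y) in both orders. *)
Lemma haar_integral_opp (f : G -> R) : continuous f -> (forall x, 0 <= f x) ->
  (\int[mu]_x (f (- (x : G)))%:E = \int[mu]_x (f x)%:E)%E.
Proof.
move=> cf f0.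
have mf := @continuous_borel R G f cf.
have mfN : measurable_fun [set: BG] (fun x : BG => f (- (x : G))).
  apply: (@continuous_borel R G (fun x => f (- x))) => x.
  by apply: continuous_comp; [exact: opp_continuous|exact: cf].
have mk : measurable_fun [set: BG * BG] (fun z : BG * BG => (f ((z.1 : G) - z.2))%:E).
  apply/measurable_EFinP.
  apply: (continuous_prod_measurable cG (k := fun z : G * G => f (z.1 - z.2))) => z.
  by apply: continuous_comp; [exact: sub_continuous|exact: cf].
have mfE : measurable_fun [set: BG] (fun x : BG => (f x)%:E) by exact/measurable_EFinP.
have mfNE : measurable_fun [set: BG] (fun x : BG => (f (- (x : G)))%:E).
  exact/measurable_EFinP.
have f0' x : (0 <= (f x)%:E)%E by rewrite lee_fin.
(* Since x - y = -(y - x), this is translation invariance in y. *)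
have inner1 (x : BG) : (\int[mu]_y (f ((x : G) - y))%:E = \int[mu]_y (f (- (y : G)))%:E)%E.
  rewrite -(mu_preserving_ge0_integral (addr_preserving (- (x : G))) mfNE (fun=> f0' _)).
  by apply: eq_integral => y _; rewrite opprD opprK addrC.
have inner2 (y : BG) : (\int[mu]_x (f ((x : G) - y))%:E = \int[mu]_x (f x)%:E)%E.
  exact: (mu_preserving_ge0_integral (addr_preserving (- (y : G))) mfE (fun=> f0' _)).
have := @fubini_tonelli _ _ BG BG R mu mu _ mk (fun z => f0' _).
under eq_integral do rewrite inner1.
under [in X in _ = X -> _]eq_integral do rewrite inner2.
(* Both iterated integrals are constants times the total mass, which is positive and finite and
   therefore cancels. *)
rewrite (integral_cst mu measurableT (\int[mu]_y _)%E).
rewrite (integral_cst mu measurableT (\int[mu]_x (f x)%:E)%E) => h.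
have mTf := mufin measurableT.
by apply/le_anti/andP; split; rewrite -(lee_pmul2r mTf mu0) h.
Qed.

Let oppM : measurable_fun [set: BG] (fun x : BG => - (x : G) : BG).
Proof. by apply: continuous_borel_self; exact: opp_continuous. Qed.

Let mopp (A : set BG) : measurable A -> measurable ((fun x : BG => - (x : G)) @^-1` A).
Proof. by move=> mA; rewrite -[X in measurable X]setTI; exact: oppM. Qed.

(** For compact K inside U, a Urysohn function f lies between the indicators of K and U. Its
    integral equals that of f(-x), which is at most the measure of -U; inner regularity
    concludes. *)
Let open_opp_le (U : set G) : open U -> (mu U <= mu ((fun x : G => (- x)%R) @^-1` U))%E.
Proof.
move=> oU; have [_ _ _ _ ->//] := Hmu.
apply: ge_ereal_sup => _ [K [cK KU] <-].
have [f [cf f01 fK fU]] := urysohn_G (compact_closed HG cK) oU KU.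
have f0 x : 0 <= f x by have /andP[] := f01 x.
have mU := open_borel oU.
have mf := @continuous_borel R G f cf.
apply: (@le_trans _ _ (\int[mu]_x (f x)%:E)%E).
  apply: (@le_trans _ _ (\int[mu]_x (\1_(K : set BG) x)%:E)%E).
    by rewrite integral_indic ?setIT//; exact: compact_borel.
  apply: ge0_le_integral => //=.
  - by apply/measurable_EFinP/measurable_indic; exact: compact_borel.
  - exact/measurable_EFinP.
  - move=> x _; rewrite lee_fin indicE.
    by case: (boolP (x \in _)) => // /[!inE] /fK ->.
rewrite -haar_integral_opp//.
apply: (@le_trans _ _ (\int[mu]_x (\1_((fun x : BG => - (x : G)) @^-1` U) x)%:E)%E); last first.
  by rewrite integral_indic ?setIT//; exact: mopp.
apply: ge0_le_integral => //=.
- by move=> x _; rewrite lee_fin.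
- by apply/measurable_EFinP; exact: (measurableT_comp mf oppM).
- by apply/measurable_EFinP/measurable_indic; exact: mopp.
- move=> x _; rewrite lee_fin indicE.
  case: (boolP (x \in _)) => [_|/negP nx]; first by have /andP[] := f01 (- x).
  by rewrite fU// => Ux; apply: nx; rewrite inE.
Qed.

(** Outer regularity extends the inequality for open sets to all Borel sets. Inversion is an
    involution, so the same inequality for -A gives the converse. *)
Lemma opp_preserving : mu_preserving (fun x : BG => - (x : G)).
Proof.
have NN (A : set G) : (fun x : G => - x) @^-1` ((fun x : G => (- x)%R) @^-1` A) = A.
  by apply/seteqP; split => x /=; rewrite opprK.
have oN (U : set G) : open U -> open ((fun x : G => (- x)%R) @^-1` U).
  by move=> oU; apply: open_comp => // x _; exact: opp_continuous.
have le (A : set BG) : measurable A -> (mu ((fun x : BG => (- (x : G))%R) @^-1` A) <= mu A)%E.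
  move=> mA; have [_ _ _ /(_ A mA) -> _] := Hmu.
  apply: le_ereal_inf_tmp => _ [U [oU AU] <-].
  apply: (@le_trans _ _ (mu ((fun x : G => (- x)%R) @^-1` U))).
    apply: le_measure; rewrite ?inE; [exact: mopp| |by move=> x /AU].
    by apply: open_borel; exact: oN.
  by rewrite -[in leRHS](NN U); apply: open_opp_le; exact: oN.
split => // A mA; apply/eqP; rewrite eq_le le//=.
by rewrite -[in leLHS](NN A); apply: le; exact: mopp.
Qed.

Lemma mu_preserving_comp S T : mu_preserving S -> mu_preserving T ->
  mu_preserving (S \o T).
Proof.
move=> [mS pS] [mT pT]; split; first exact: measurableT_comp.
move=> A mA; rewrite comp_preimage pT ?pS// -[X in measurable X]setTI.
exact: mS.
Qed.

Lemma subl_preserving (a : G) : mu_preserving (fun x : BG => a - (x : G)).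
Proof.
rewrite (_ : (fun x : BG => _) = (fun x : BG => (x : G) + a) \o (fun x : BG => - (x : G))).
  by apply: mu_preserving_comp; [exact: addr_preserving|exact: opp_preserving].
by apply/funext => x /=; rewrite addrC.
Qed.

End Haar.

(** * Density of the continuous functions in L^1 *)

Section Density.
Variables (R : realType) (G : topologicalZmodType).
Local Notation BG := (borelG G).
Variable mu : {finite_measure set BG -> \bar R}.
Hypotheses (HG : hausdorff_space G) (Hmu : haar_measure mu).

Definition continuous_approximable (f : BG -> R) :=
  measurable_fun setT f /\ forall e : R, 0 < e ->
  exists2 g : G -> R, continuous g & (\int[mu]_x `|f x - g x|%:E < e%:E)%E.

Let mdist (f g : BG -> R) : measurable_fun setT f -> measurable_fun setT g ->
  measurable_fun setT (fun x => `|f x - g x|%:E).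
Proof.
by move=> mf mg; apply/measurable_EFinP/measurableT_comp => //; exact: measurable_funB.
Qed.

Let l1_triangle (f g h : BG -> R) : measurable_fun setT f ->
  measurable_fun setT g -> measurable_fun setT h ->
  (\int[mu]_x `|f x - h x|%:E <=
   \int[mu]_x `|f x - g x|%:E + \int[mu]_x `|g x - h x|%:E)%E.
Proof.
move=> mf mg mh; rewrite -ge0_integralD//; [|exact: mdist|exact: mdist].
apply: ge0_le_integral => //; first exact: mdist.
- by apply: emeasurable_funD; exact: mdist.
- by move=> x _; rewrite -EFinD lee_fin ler_distD.
Qed.

(** Inner regularity concerns open sets only, so the compact K is taken inside an open U containing
    A, and need not lie in A. A function equal to 1 on K and 0 off U differs from the indicator of A
    by at most the sum of the indicators of U \ A and U \ K, both of measure below e/2. *)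
Lemma continuous_approximable_indic (A : set BG) : measurable A ->
  continuous_approximable (\1_A).
Proof.
move=> mA; split; first exact: measurable_indic.
move=> e e0; have e20 : 0 < e / 2 by rewrite divr_gt0.
have fA := fin_num_measure mu A mA.
have [_ _ _ outer inner] := Hmu.
have [U oU [AU muU]] : exists2 U : set G, open U & A `<=` U /\ (mu U < mu A + (e / 2)%:E)%E.
  have : (mu A < mu A + (e / 2)%:E)%E by rewrite lteDl.
  rewrite {1}outer// => /ereal_inf_lt[_ [U [oU AU] <-] ?].
  by exists U.
have mU := open_borel oU; have fU := fin_num_measure mu U mU.
have [K cK [KU muK]] : exists2 K : set G, compact K & K `<=` U /\ (mu U - (e / 2)%:E < mu K)%E.
  have : (mu U - (e / 2)%:E < mu U)%E by rewrite lteBlDr// lteDl.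
  rewrite {2}inner// => /ereal_sup_gt[_ [K [cK KU] <-] ?].
  by exists K.
have cK' := compact_borel HG cK; have fK := fin_num_measure mu K cK'.
have [f [cf f01 f1 f0]] := urysohn_G HG Hmu (compact_closed HG cK) oU KU.
exists f => //; have mf := continuous_borel cf.
have mUA := measurableD mU mA; have mUK := measurableD mU cK'.
apply: (@le_lt_trans _ _ (\int[mu]_x ((\1_(U `\` A) x)%:E + (\1_(U `\` K) x)%:E))%E).
  apply: ge0_le_integral => //.
  - by apply: mdist => //; exact: measurable_indic.
  - by apply: emeasurable_funD; apply/measurable_EFinP/measurable_indic.
  - move=> x _; rewrite -EFinD lee_fin !indicE !in_setD.
    have /andP[fx0 fx1] := f01 x.
    have [xU|xU] := boolP (x \in U); last first.
      rewrite f0 => [|xU']; last by move: xU; rewrite notin_setE.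
      suff /negbTE-> : x \notin A by rewrite subrr normr0 addr0.
      by apply: contra xU; rewrite !inE; exact: AU.
    have [xA|xA] := boolP (x \in A); have [xK|xK] := boolP (x \in K) => /=.
    - by rewrite f1 ?subrr ?normr0 ?addr0//; exact: set_mem.
    - by rewrite add0r ger0_norm ?subr_ge0// gerBl.
    - by rewrite addr0 sub0r normrN ger0_norm.
    - by rewrite sub0r normrN ger0_norm// (le_trans fx1)// lerDl.
rewrite ge0_integralD//; [|exact/measurable_EFinP/measurable_indic..].
rewrite !integral_indic// !setIT.
have e1 : mu (U `\` A) = (mu U - mu A)%E by rewrite measureD ?setIidr// ltey_eq fU.
have e2 : mu (U `\` K) = (mu U - mu K)%E by rewrite measureD ?setIidr// ltey_eq fU.
apply: (@le_lt_trans _ _ (mu (U `\` A) + mu (U `\` K))%E) => //; rewrite e1 e2.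
move: muU muK; rewrite -(fineK fA) -(fineK fU) -(fineK fK).
rewrite -!EFinD -?EFinB !lte_fin => h1 h2.
rewrite [ltRHS]splitr ltrD// ltrBlDr addrC//.
by move: h2; rewrite ltrBlDr.
Qed.

Lemma continuous_approximable_lin (a : R) (f g : BG -> R) :
  continuous_approximable f -> continuous_approximable g ->
  continuous_approximable (fun x => a * f x + g x).
Proof.
move=> [mf Hf] [mg Hg]; split.
  by apply: measurable_funD => //; exact: measurable_funM.
move=> e e0; have e20 : 0 < e / 2 by rewrite divr_gt0.
have a0 : 0 < `|a| + 1 by rewrite ltr_wpDl.
have [u cu hu] := Hf (e / 2 / (`|a| + 1)) (divr_gt0 e20 a0).
have [v cv hv] := Hg _ e20.
have mu' := continuous_borel cu; have mv := continuous_borel cv.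
exists (fun x => a * u x + v x).
  move=> x; apply: (@continuousD _ R G (fun x => a * u x) v); last exact: cv.
  by apply: (@continuousM R G (fun=> a) u); [exact: cvg_cst|exact: cu].
apply: (@le_lt_trans _ _ (\int[mu]_x (`|a|%:E * `|f x - u x|%:E + `|g x - v x|%:E))%E).
  apply: ge0_le_integral => //.
  - apply: mdist; first by apply: measurable_funD => //; exact: measurable_funM.
    by apply: measurable_funD => //; exact: measurable_funM.
  - apply: emeasurable_funD; last exact: mdist.
    by apply: emeasurable_funM => //; exact: mdist.
  - move=> x _; rewrite -EFinM -EFinD lee_fin -normrM.
    by rewrite opprD addrACA -mulrBr ler_normD.
rewrite ge0_integralD//; last 2 first.
- by apply: emeasurable_funM => //; exact: mdist.
- exact: mdist.
rewrite ge0_integralZl//; last exact: mdist.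
rewrite (splitr e) EFinD; apply: lteD => //.
apply: (@le_lt_trans _ _ ((`|a| + 1)%:E * \int[mu]_x `|f x - u x|%:E)%E).
  by rewrite lee_wpmul2r ?lee_fin ?lerDl// integral_ge0.
by rewrite muleC -lte_pdivlMr// EFinM.
Qed.

Import HBSimple.

(** Simple functions are dense in L^1, and a simple function is a finite linear combination of
    indicators. *)
Lemma continuous_approximable_integrable (f : BG -> R) :
  mu.-integrable setT (EFin \o f) -> continuous_approximable f.
Proof.
move=> fi; have mf : measurable_fun setT f by apply/measurable_EFinP; exact: (measurable_int mu).
split => // e e0; have e20 : 0 < e / 2 by rewrite divr_gt0.
have [h [hi _ hcv]] := approximation_sfun_integrable measurableT fi.
have : \forall n \near \oo, (\int[mu]_x `|(EFin \o f) x - (h n x)%:E| < (e / 2)%:E)%E.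
  apply: (hcv [set x | (x < (e / 2)%:E)%E]); apply: open_nbhs_nbhs; split.
    exact: open_ereal_lt_ereal.
  by rewrite /= lte_fin.
move=> [n _ /(_ n (leqnn n)) /= hn].
have [_ /(_ _ e20)[g cg hg]] : continuous_approximable (h n).
  rewrite (_ : (h n : BG -> R) =
      fun x => \sum_(y <- fset_set (range (h n))) (y * \1_(h n @^-1` [set y]) x)); last first.
    by apply/funext => x; rewrite [LHS]fimfunE fsbig_finite.
  (* Induction on the list of values; the empty sum is the indicator of the empty set. *)
  elim: (fset_set _ : seq R) => [|y r IH].
    rewrite (_ : (fun x => _) = \1_set0); last first.
      by apply/funext => x; rewrite big_nil indic0.
    exact: continuous_approximable_indic.
  rewrite (_ : (fun x => _) = fun x => y * \1_(h n @^-1` [set y]) x +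
     \sum_(y <- r) (y * \1_(h n @^-1` [set y]) x)); last first.
    by apply/funext => x; rewrite big_cons.
  apply: continuous_approximable_lin => //.
  by apply: continuous_approximable_indic; exact: measurable_sfunP.
exists g => //; have mg := continuous_borel cg.
apply: (le_lt_trans (@l1_triangle f (h n) g _ _ _)) => //.
rewrite (splitr e) EFinD; apply: lteD => //.
Qed.

End Density.

(** * Complex-valued integrals *)

Section ComplexModulus.
Variable R : realType.
Implicit Types z w : R[i].

Lemma cabs_normc z : cabs z = Normc.normc z.
Proof. by case: z. Qed.

Lemma cabs_ge0 z : 0 <= cabs z.
Proof. exact: sqrtr_ge0. Qed.

Lemma cabsM z w : cabs (z * w) = cabs z * cabs w.
Proof. by rewrite !cabs_normc Normc.normcM. Qed.

Lemma cabsD z w : cabs (z + w) <= cabs z + cabs w.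
Proof. by rewrite !cabs_normc; exact: le_normcD. Qed.

Lemma cabsN z : cabs (- z) = cabs z.
Proof. by case: z => a b; rewrite /cabs /= !sqrrN. Qed.

Lemma cabs_conj z : cabs (z^*)%C = cabs z.
Proof. by case: z => a b; rewrite /cabs /= sqrrN. Qed.

Lemma cabs_distC z w : cabs (z - w) = cabs (w - z).
Proof. by rewrite -cabsN opprB. Qed.

Lemma cabs_real (x : R) : cabs (x%:C)%C = `|x|.
Proof. by rewrite /cabs /= expr0n /= addr0 sqrtr_sqr. Qed.

Lemma cabs0 : cabs (0 : R[i]) = 0.
Proof. by rewrite -[0]/((0 : R)%:C)%C cabs_real normr0. Qed.

Lemma Re_le_cabs z : `|complex.Re z| <= cabs z.
Proof. by rewrite -sqrtr_sqr ler_wsqrtr// lerDl sqr_ge0. Qed.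

Lemma Im_le_cabs z : `|complex.Im z| <= cabs z.
Proof. by rewrite -sqrtr_sqr ler_wsqrtr// lerDr sqr_ge0. Qed.

Lemma cabs_le_ReIm z : cabs z <= `|complex.Re z| + `|complex.Im z|.
Proof.
rewrite -[leRHS]ger0_norm ?addr_ge0// -sqrtr_sqr ler_wsqrtr// sqrrD.
by rewrite !real_normK ?num_real// lerD2r lerDl mulrn_wge0// mulr_ge0.
Qed.

End ComplexModulus.

Section ComplexIntegral.
Variables (R : realType) (G : topologicalZmodType).
Local Notation BG := (borelG G).
Variable mu : {finite_measure set BG -> \bar R}.
Implicit Types f g : G -> R[i].

Lemma cmeasurableD f g : cmeasurable f -> cmeasurable g -> cmeasurable (f \+ g).
Proof.
move=> [rf jf] [rg jg]; split.
- rewrite (_ : (fun x : BG => _) = fun x : BG => complex.Re (f x) + complex.Re (g x)).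
    exact: measurable_funD.
  by apply/funext => x /=; case: (f x); case: (g x).
- rewrite (_ : (fun x : BG => _) = fun x : BG => complex.Im (f x) + complex.Im (g x)).
    exact: measurable_funD.
  by apply/funext => x /=; case: (f x); case: (g x).
Qed.

Lemma cmeasurableM f g : cmeasurable f -> cmeasurable g -> cmeasurable (f \* g).
Proof.
move=> [rf jf] [rg jg]; split.
- rewrite (_ : (fun x : BG => _) = fun x : BG =>
     complex.Re (f x) * complex.Re (g x) - complex.Im (f x) * complex.Im (g x)).
    by apply: measurable_funB; exact: measurable_funM.
  by apply/funext => x /=; case: (f x); case: (g x).
- rewrite (_ : (fun x : BG => _) = fun x : BG =>
     complex.Re (f x) * complex.Im (g x) + complex.Im (f x) * complex.Re (g x)).
    by apply: measurable_funD; exact: measurable_funM.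
  by apply/funext => x /=; case: (f x); case: (g x).
Qed.

Lemma cmeasurable_cst (c : R[i]) : cmeasurable (fun _ : G => c).
Proof. by split; exact: measurable_cst. Qed.

Lemma cmeasurableN f : cmeasurable f -> cmeasurable (fun x => - f x).
Proof.
move=> mf; rewrite (_ : (fun x => _) = (fun=> -1) \* f).
  by apply: cmeasurableM => //; exact: cmeasurable_cst.
by apply/funext => x /=; rewrite mulN1r.
Qed.

Lemma cmeasurableB f g : cmeasurable f -> cmeasurable g -> cmeasurable (f \- g).
Proof. by move=> mf mg; apply: cmeasurableD => //; exact: cmeasurableN. Qed.

Lemma cabs_measurable f : cmeasurable f ->
  measurable_fun [set: BG] (fun x : BG => cabs (f x)).
Proof.
move=> [rf jf]; apply: measurableT_comp.
  by apply: continuous_measurable_fun; exact: sqrt_continuous.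
by apply: measurable_funD; exact: measurable_funX.
Qed.

Lemma cmeasurable_comp f (T : BG -> BG) : mu_preserving mu T ->
  cmeasurable f -> cmeasurable (fun x => f (T x)).
Proof.
by move=> [mT _] [rf jf]; split;
  [exact: (measurableT_comp rf mT)|exact: (measurableT_comp jf mT)].
Qed.

Lemma L1P f : L1 mu f <-> cmeasurable f /\
  mu.-integrable setT (EFin \o (fun x : BG => cabs (f x))).
Proof.
split=> -[mf fi]; split => //.
- apply/integrableP; split; first by apply/measurable_EFinP; exact: cabs_measurable.
  under eq_integral do rewrite /= ger0_norm ?cabs_ge0//.
  exact: fi.
- move/integrableP : fi => [_].
  by under eq_integral do rewrite /= ger0_norm ?cabs_ge0//.
Qed.

Lemma L1_dom f (b : BG -> R) : cmeasurable f ->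
  mu.-integrable setT (EFin \o b) -> (forall x, cabs (f x) <= b x) -> L1 mu f.
Proof.
move=> mf bi fb; apply/L1P; split => //; apply: le_integrable bi => //.
  by apply/measurable_EFinP; exact: cabs_measurable.
move=> x _; rewrite /= lee_fin ger0_norm ?cabs_ge0//.
by rewrite (le_trans (fb x))// ler_norm.
Qed.

Lemma L1_Re f : L1 mu f -> mu.-integrable setT (EFin \o (fun x : BG => complex.Re (f x))).
Proof.
move=> /L1P[[mr mi] fi]; apply: le_integrable fi => //; first exact/measurable_EFinP.
by move=> x _ /=; rewrite lee_fin [leRHS]ger0_norm ?cabs_ge0// Re_le_cabs.
Qed.

Lemma L1_Im f : L1 mu f -> mu.-integrable setT (EFin \o (fun x : BG => complex.Im (f x))).
Proof.
move=> /L1P[[mr mi] fi]; apply: le_integrable fi => //; first exact/measurable_EFinP.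
by move=> x _ /=; rewrite lee_fin [leRHS]ger0_norm ?cabs_ge0// Im_le_cabs.
Qed.

Lemma L1Z (c : R[i]) f : L1 mu f -> L1 mu (fun x => c * f x).
Proof.
move=> /L1P[mf fi]; apply: (@L1_dom _ (fun x => cabs c * cabs (f x))).
- by apply: (@cmeasurableM (fun=> c)) => //; exact: cmeasurable_cst.
- exact: (integrableZl _ _ fi).
- by move=> x; rewrite cabsM.
Qed.

Lemma L1M f (g : G -> R[i]) (M : R) : L1 mu f -> cmeasurable g ->
  (forall x, cabs (g x) <= M) -> L1 mu (f \* g).
Proof.
move=> /L1P[mf fi] mg gM; apply: (@L1_dom _ (fun x => M * cabs (f x))).
- exact: cmeasurableM.
- exact: (integrableZl _ _ fi).
- by move=> x; rewrite cabsM mulrC ler_wpM2r ?cabs_ge0.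
Qed.

Lemma L1B f g : L1 mu f -> L1 mu g -> L1 mu (f \- g).
Proof.
move=> /L1P[mf fi] /L1P[mg gi].
apply: (@L1_dom _ (fun x => cabs (f x) + cabs (g x))).
- exact: cmeasurableB.
- exact: (integrableD _ fi gi).
- by move=> x; rewrite (le_trans (cabsD _ _))// cabsN.
Qed.

Lemma L1_bounded f (M : R) : cmeasurable f -> (forall x, cabs (f x) <= M) -> L1 mu f.
Proof.
move=> mf fM; apply: (@L1_dom _ (fun=> M)) => //.
exact: (finite_measure_integrable_cst mu M measurableT).
Qed.

Lemma L1_comp f T : mu_preserving mu T -> L1 mu f -> L1 mu (fun x => f (T x)).
Proof.
move=> pT /L1P[mf fi]; apply/L1P; split; first exact: cmeasurable_comp.
exact: (mu_preserving_integrable pT fi).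
Qed.

Lemma cintegral_comp f T : mu_preserving mu T -> cmeasurable f ->
  cintegral mu (fun x => f (T x)) = cintegral mu f.
Proof.
move=> pT [mr mi]; congr Complex; congr fine.
- by apply: (mu_preserving_integral pT (f := fun x : BG => (complex.Re (f x))%:E)); exact/measurable_EFinP.
- by apply: (mu_preserving_integral pT (f := fun x : BG => (complex.Im (f x))%:E)); exact/measurable_EFinP.
Qed.

Lemma cintegralB f g : L1 mu f -> L1 mu g ->
  cintegral mu (f \- g) = cintegral mu f - cintegral mu g.
Proof.
move=> f1 g1; rewrite /cintegral [RHS]/GRing.add /= /GRing.opp /=.
rewrite -(RintegralB measurableT (L1_Re f1) (L1_Re g1)).
rewrite -(RintegralB measurableT (L1_Im f1) (L1_Im g1)).
by congr Complex; apply: eq_Rintegral => x _ /=; case: (f x); case: (g x).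
Qed.

Lemma cintegralZl (c : R[i]) f : L1 mu f ->
  cintegral mu (fun x => c * f x) = c * cintegral mu f.
Proof.
move=> f1; have fr := L1_Re f1; have fm := L1_Im f1.
case: c => a b; rewrite /cintegral [RHS]/GRing.mul /=.
have zr (k : R) : mu.-integrable setT (EFin \o (fun x : BG => k * complex.Re (f x))).
  exact: (integrableZl _ _ fr).
have zi (k : R) : mu.-integrable setT (EFin \o (fun x : BG => k * complex.Im (f x))).
  exact: (integrableZl _ _ fm).
rewrite -!RintegralZl// -RintegralB// -RintegralD//.
by congr Complex; apply: eq_Rintegral => x _ /=; case: (f x).
Qed.

Lemma cintegralZr (c : R[i]) f : L1 mu f ->
  cintegral mu (fun x => f x * c) = cintegral mu f * c.
Proof.
by move=> f1; rewrite mulrC -cintegralZl//; congr (cintegral mu _); apply/funext => x; rewrite mulrC.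
Qed.

(* Rotate the integral onto the real axis: |I|^2 = Re (conj I * I). *)
Lemma cabs_cintegral f : L1 mu f ->
  cabs (cintegral mu f) <= \int[mu]_x cabs (f x).
Proof.
move=> f1; have [mf fi] := (L1P f).1 f1; set I := cintegral mu f.
have [I0|I0] := eqVneq (cabs I) 0; first by rewrite I0 Rintegral_ge0// => x _; exact: cabs_ge0.
have {}I0 : 0 < cabs I by rewrite lt_neqAle eq_sym I0 cabs_ge0.
rewrite -(ler_pM2l I0).
have -> : cabs I * cabs I = complex.Re ((I^*)%C * I).
  rewrite -expr2 sqr_sqrtr ?addr_ge0 ?sqr_ge0//.
  by case: (I) => a b /=; rewrite !expr2 mulNr opprK.
rewrite -cintegralZl// /= -RintegralZl//.
have h1 := L1_Re (L1Z (I^*)%C f1).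
apply: le_Rintegral => //; first exact: (integrableZl _ _ fi).
move=> x _; rewrite (le_trans (ler_norm _))// (le_trans (Re_le_cabs _))// cabsM.
by rewrite -[leLHS]/(cabs (I^*)%C * cabs (f x)) cabs_conj.
Qed.

Lemma L1norm_fine f : L1 mu f -> L1norm mu f = (\int[mu]_x cabs (f x))%:E.
Proof. by move=> /L1P[_ fi]; rewrite fineK//; exact: integrable_fin_num. Qed.

(** The product bound makes k integrable on the product, and each of its sections integrable, not
    merely almost all of them. *)
Lemma Rintegral_fubini (k : BG * BG -> R) (a b : BG -> R) :
  measurable_fun setT k ->
  mu.-integrable setT (EFin \o a) -> mu.-integrable setT (EFin \o b) ->
  (forall x y, `|k (x, y)| <= a x * b y) ->
  \int[mu]_x \int[mu]_y k (x, y) = \int[mu]_y \int[mu]_x k (x, y).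
Proof.
move=> mk ai bi kab.
have mkE : measurable_fun setT (EFin \o k) by exact/measurable_EFinP.
have i1 x : mu.-integrable setT (fun y => (k (x, y))%:E).
  apply: (@le_integrable _ _ _ mu setT measurableT _ (fun y => (a x * b y)%:E)).
  - exact: (measurableT_comp mkE (pair1_measurable x)).
  - by move=> y _; rewrite /= lee_fin (le_trans (kab x y))// ler_norm.
  - exact: (integrableZl _ _ bi).
have i2 y : mu.-integrable setT (fun x => (k (x, y))%:E).
  apply: (@le_integrable _ _ _ mu setT measurableT _ (fun x => (a x * b y)%:E)).
  - exact: (measurableT_comp mkE (pair2_measurable y)).
  - by move=> x _; rewrite /= lee_fin (le_trans (kab x y))// ler_norm.
  - exact: (integrableZr _ _ ai).
have kint : (mu \x mu)%E.-integrable setT (EFin \o k).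
  apply/(integrable12ltyP _ _ mkE).
  set A := (\int[mu]_x `|(a x)%:E|)%E; set B := (\int[mu]_y `|(b y)%:E|)%E.
  have /integrableP[ma Afin] := ai; have /integrableP[mb Bfin] := bi.
  have maE : measurable_fun setT (fun x => `|(a x)%:E|%E) by exact: measurableT_comp.
  have mbE : measurable_fun setT (fun x => `|(b x)%:E|%E) by exact: measurableT_comp.
  have B0 : (0 <= B)%E by exact: integral_ge0.
  apply: (@le_lt_trans _ _ (\int[mu]_x (`|(a x)%:E| * B))%E).
    apply: ge0_le_integral => //.
    - by move=> x _; exact: integral_ge0.
    - apply: (measurable_fun_fubini_tonelli_F (abse \o (EFin \o k))) => //=.
      exact: measurableT_comp.
    - exact: emeasurable_funM.
    - move=> x _; rewrite -ge0_integralZl//.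
      apply: ge0_le_integral => //.
      + have := measurableT_comp mkE (pair1_measurable x).
        exact: measurableT_comp.
      + exact: emeasurable_funM.
      + by move=> y _; rewrite /= lee_fin -normrM (le_trans (kab x y))// ler_norm.
  rewrite ge0_integralZr// lte_mul_pinfty ?integral_ge0//.
  by rewrite ge0_fin_numE// integral_ge0.
rewrite /Rintegral; congr fine.
(* [Rintegral] applies [fine] to every inner integral; all of these are finite, so nothing
   changes. *)
transitivity (\int[mu]_x \int[mu]_y (k (x, y))%:E)%E.
  by apply: eq_integral => x _; rewrite fineK//; exact: integrable_fin_num.
rewrite (Fubini kint).
by apply: eq_integral => y _; rewrite fineK//; exact: integrable_fin_num.
Qed.

Lemma cintegral_fubini (k : G -> G -> R[i]) (a b : BG -> R) :
  measurable_fun [set: BG * BG] (fun z : BG * BG => complex.Re (k z.1 z.2)) ->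
  measurable_fun [set: BG * BG] (fun z : BG * BG => complex.Im (k z.1 z.2)) ->
  mu.-integrable setT (EFin \o a) -> mu.-integrable setT (EFin \o b) ->
  (forall x y, cabs (k x y) <= a x * b y) ->
  cintegral mu (fun x => cintegral mu (k x)) =
  cintegral mu (fun y => cintegral mu (k ^~ y)).
Proof.
move=> mr mi ai bi kab; congr Complex.
- apply: (Rintegral_fubini mr ai bi) => x y.
  exact: le_trans (Re_le_cabs _) (kab x y).
- apply: (Rintegral_fubini mi ai bi) => x y.
  exact: le_trans (Im_le_cabs _) (kab x y).
Qed.

End ComplexIntegral.

(** * Convolution *)

(* [convex.conv], imported from MathComp-Analysis, hides the convolution. *)
Local Notation conv := Defs.conv.

Section Convolution.
Variables (R : realType) (G : topologicalZmodType).
Local Notation BG := (borelG G).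
Variable mu : {finite_measure set BG -> \bar R}.
Hypotheses (HG : hausdorff_space G) (Hmu : haar_measure mu).
Implicit Types f g h : G -> R[i].

(** On the compact group these are exactly the functions in [Cc]. *)
Definition ccontinuous f :=
  continuous (fun x => complex.Re (f x)) /\ continuous (fun x => complex.Im (f x)).

Let cG : compact [set: G]. Proof. exact: haar_compact HG Hmu. Qed.
Let subP (x : G) := subl_preserving HG Hmu x.

Lemma ccontinuous_measurable f : ccontinuous f -> cmeasurable f.
Proof. by move=> [cr ci]; split; exact: continuous_borel. Qed.

Lemma ccontinuous_bounded f : ccontinuous f ->
  exists2 M : R, 0 <= M & forall x, cabs (f x) <= M.
Proof.
move=> [cr ci]; have [M1 h1] := continuous_bounded cG cr.
have [M2 h2] := continuous_bounded cG ci.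
have hM x : cabs (f x) <= M1 + M2.
  by rewrite (le_trans (cabs_le_ReIm _))// lerD.
by exists (M1 + M2) => //; exact: le_trans (cabs_ge0 _) (hM 0).
Qed.

Lemma ccontinuous_uniform f (e : R) : ccontinuous f -> 0 < e ->
  \forall u \near (0 : G), forall x, cabs (f (x + u) - f x) < e.
Proof.
move=> [cr ci] e0; have e20 : 0 < e / 2 by rewrite divr_gt0.
have H1 := continuous_uniform cG cr e20.
have H2 := continuous_uniform cG ci e20.
near=> u => x; rewrite (le_lt_trans (cabs_le_ReIm _))// (splitr e).
have h1 : forall x, `|complex.Re (f (x + u)) - complex.Re (f x)| < e / 2 by near: u.
have h2 : forall x, `|complex.Im (f (x + u)) - complex.Im (f x)| < e / 2 by near: u.
have := ltrD (h1 x) (h2 x); congr (_ < _).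
by case: (f (x + u)) => a b; case: (f x).
Unshelve. all: by end_near. Qed.

Lemma uniform_ccontinuous f : (forall e : R, 0 < e ->
    \forall u \near (0 : G), forall x, cabs (f (x + u) - f x) < e) ->
  ccontinuous f.
Proof.
move=> H; have H' x (e : R) : 0 < e -> \forall y \near x, cabs (f x - f y) < e.
  move=> e0; have cs : (fun y : G => y - x) @ x --> (0 : G).
    by rewrite -(subrr x); exact: (@addr_continuous_G G (- x)).
  have := cs _ (H e e0); rewrite /nbhs /=; apply: filterS => y /= /(_ x).
  by rewrite (addrC x) subrK cabs_distC.
split=> x; apply/cvgrPdist_lt => e e0; near=> y.
- apply: (@le_lt_trans _ _ (cabs (f x - f y))); last by near: y; exact: H'.
  apply: le_trans (Re_le_cabs _).
  by case: (f x) => a b; case: (f y).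
- apply: (@le_lt_trans _ _ (cabs (f x - f y))); last by near: y; exact: H'.
  apply: le_trans (Im_le_cabs _).
  by case: (f x) => a b; case: (f y).
Unshelve. all: by end_near. Qed.

Lemma ccontinuous_L1 f : ccontinuous f -> L1 mu f.
Proof.
move=> cf; have [M _ fM] := ccontinuous_bounded cf.
exact: L1_bounded (ccontinuous_measurable cf) fM.
Qed.

Let sub_measurable f (x : G) : cmeasurable f -> cmeasurable (fun y => f (x - y)).
Proof. exact: cmeasurable_comp. Qed.

(** A continuous [h] is bounded. As the integrand is integrable at every x, identities between
    convolutions hold everywhere and not just almost everywhere. *)
Lemma conv_integrand_L1 f h (x : G) : L1 mu f -> ccontinuous h ->
  L1 mu (fun y => f y * h (x - y)).
Proof.
move=> f1 ch; have [M _ hM] := ccontinuous_bounded ch.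
apply: (@L1M _ _ mu f (fun y => h (x - y)) M) => //.
exact: sub_measurable (ccontinuous_measurable ch).
Qed.

(** The increment of f * h under a shift u is at most the L^1 norm of f times the supremum of |h(z +
    u) - h(z)|. The bound e / (N + 1) allows N = 0. *)
Lemma conv_ccontinuous f h : L1 mu f -> ccontinuous h -> ccontinuous (conv mu f h).
Proof.
move=> f1 ch; apply: uniform_ccontinuous => e e0.
have [mf fi] := (L1P mu f).1 f1.
set N := \int[mu]_x cabs (f x).
have N0 : 0 <= N by apply: Rintegral_ge0 => x _; exact: cabs_ge0.
have N1 : 0 < N + 1 by rewrite ltr_wpDl.
have H := ccontinuous_uniform ch (divr_gt0 e0 N1).
near=> u => x.
have hu : forall x, cabs (h (x + u) - h x) < e / (N + 1) by near: u.
rewrite /conv -cintegralB; [|exact: conv_integrand_L1..].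
apply: (@le_lt_trans _ _ (\int[mu]_y (e / (N + 1) * cabs (f y)))).
  apply: le_trans (cabs_cintegral _) _.
    by apply: L1B; exact: conv_integrand_L1.
  apply: le_Rintegral => //.
  - by have [] := (L1P mu _).1 (L1B (conv_integrand_L1 (x + u) f1 ch) (conv_integrand_L1 x f1 ch)).
  - exact: (integrableZl _ _ fi).
  - move=> y _ /=; rewrite -mulrBr cabsM mulrC ler_wpM2r ?cabs_ge0// ltW//.
    by rewrite addrAC hu.
rewrite RintegralZl// -/N -mulrA -ltr_pdivlMl// mulVf ?gt_eqF//.
by rewrite mulrC ltr_pdivrMr// mul1r ltrDl.
Unshelve. all: by end_near. Qed.

(** Substitute x - y for y, which preserves [mu] because inversion does. *)
Lemma convC f h : cmeasurable f -> cmeasurable h -> conv mu f h = conv mu h f.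
Proof.
move=> mf mh; apply/funext => x; rewrite /conv.
rewrite -(cintegral_comp (subP x) (f := fun y => h y * f (x - y))).
  by congr (cintegral mu _); apply/funext => y; rewrite subKr mulrC.
by apply: (cmeasurableM (f := h)) => //; exact: sub_measurable.
Qed.

(** In real and imaginary parts only products occur: factors in one variable are measurable through
    the projections, and the factor h(c z) by [continuous_prod_measurable]. *)
Let kernel_measurable (c : G * G -> G) f g h : continuous c ->
  cmeasurable f -> cmeasurable g -> ccontinuous h ->
  measurable_fun [set: BG * BG] (fun z : BG * BG => complex.Re (f z.1 * (g z.2 * h (c z)))) /\
  measurable_fun [set: BG * BG] (fun z : BG * BG => complex.Im (f z.1 * (g z.2 * h (c z)))).
Proof.
move=> cc [rf jf] [rg jg] [rh jh].
have m1 (k : BG -> R) : measurable_fun setT k -> measurable_fun [set: BG * BG] (fun z : BG * BG => k z.1).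
  by move=> mk; exact: (measurableT_comp mk measurable_fst).
have m2 (k : BG -> R) : measurable_fun setT k -> measurable_fun [set: BG * BG] (fun z : BG * BG => k z.2).
  by move=> mk; exact: (measurableT_comp mk measurable_snd).
have m3 (k : G -> R) : continuous k -> measurable_fun [set: BG * BG] (fun z : BG * BG => k (c z)).
  move=> ck; apply: (continuous_prod_measurable cG (k := fun z => k (c z))) => z.
  by apply: (continuous_comp (f := c)); [exact: cc|exact: ck].
have [f1 f2] := (m1 _ rf, m1 _ jf); have [g1 g2] := (m2 _ rg, m2 _ jg).
have [h1 h2] := (m3 _ rh, m3 _ jh).
split.
- rewrite (_ : (fun z : BG * BG => _) = fun z : BG * BG =>
    complex.Re (f z.1) * (complex.Re (g z.2) * complex.Re (h (c z)) - complex.Im (g z.2) * complex.Im (h (c z)))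
    - complex.Im (f z.1) * (complex.Re (g z.2) * complex.Im (h (c z)) + complex.Im (g z.2) * complex.Re (h (c z)))).
    by apply: measurable_funB; apply: measurable_funM => //;
      [apply: measurable_funB|apply: measurable_funD]; exact: measurable_funM.
  by apply/funext => z; case: (f _); case: (g _); case: (h _).
- rewrite (_ : (fun z : BG * BG => _) = fun z : BG * BG =>
    complex.Re (f z.1) * (complex.Re (g z.2) * complex.Im (h (c z)) + complex.Im (g z.2) * complex.Re (h (c z)))
    + complex.Im (f z.1) * (complex.Re (g z.2) * complex.Re (h (c z)) - complex.Im (g z.2) * complex.Im (h (c z)))).
    by apply: measurable_funD; apply: measurable_funM => //;
      [apply: measurable_funD|apply: measurable_funB]; exact: measurable_funM.
  by apply/funext => z; case: (f _); case: (g _); case: (h _).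
Qed.

(** The map [c] accommodates both h(x - (y + z)), used for associativity, and h(x - y), used for the
    Fourier transform. *)
Lemma cintegral_kernel_fubini (c : G * G -> G) f g h : continuous c ->
  L1 mu f -> L1 mu g -> ccontinuous h ->
  cintegral mu (fun x => cintegral mu (fun y => f x * (g y * h (c (x, y))))) =
  cintegral mu (fun y => cintegral mu (fun x => f x * (g y * h (c (x, y))))).
Proof.
move=> cc /L1P[mf fi] /L1P[mg gi] ch.
have [M M0 hM] := ccontinuous_bounded ch.
have [mr mi] := kernel_measurable cc mf mg ch.
apply: (@cintegral_fubini _ _ mu (fun x y => f x * (g y * h (c (x, y))))
    (fun x => cabs (f x)) (fun y => M * cabs (g y))) => //.
- by apply: eq_measurable_fun mr => -[].
- by apply: eq_measurable_fun mi => -[].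
- exact: (integrableZl _ _ gi).
- move=> x y; rewrite !cabsM ler_wpM2l ?cabs_ge0// mulrC.
  by rewrite ler_wpM2r ?cabs_ge0.
Qed.

(** Commutativity turns the claim into g * (f * h) = f * (g * h), where the continuous function
    alone depends on both integration variables. *)
Lemma convA f h g : L1 mu f -> ccontinuous h -> L1 mu g ->
  conv mu (conv mu f h) g = conv mu f (conv mu h g).
Proof.
move=> f1 ch g1; have mh := ccontinuous_measurable ch.
have mf := f1.1; have mg := g1.1.
rewrite (convC mh mg) (convC (ccontinuous_measurable (conv_ccontinuous f1 ch)) mg).
apply/funext => x; rewrite /conv.
have cc : continuous (fun z : G * G => x - (z.1 + z.2)).
  move=> z; apply: (@continuous_comp _ _ _ (fun z : G * G => z.1 + z.2) (fun y : G => x - y)).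
    exact: add_continuous.
  exact: subl_continuous_G.
transitivity (cintegral mu (fun y => cintegral mu (fun z => g y * (f z * h (x - (y + z)))))).
  congr (cintegral mu _); apply/funext => y.
  rewrite -cintegralZl; last exact: conv_integrand_L1.
  by congr (cintegral mu _); apply/funext => z; rewrite opprD addrA.
rewrite (cintegral_kernel_fubini cc g1 f1 ch).
congr (cintegral mu _); apply/funext => z.
rewrite -cintegralZl; last exact: conv_integrand_L1.
congr (cintegral mu _); apply/funext => y.
by rewrite mulrCA opprD addrA (addrAC x).
Qed.

Lemma convBl f g h : L1 mu f -> L1 mu g -> ccontinuous h ->
  conv mu (f \- g) h = conv mu f h \- conv mu g h.
Proof.
move=> f1 g1 ch; apply/funext => x; rewrite /conv /= -cintegralB; [|exact: conv_integrand_L1..].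
by congr (cintegral mu _); apply/funext => y; rewrite /= mulrBl.
Qed.

Lemma character_ccontinuous (g : G -> R[i]) : character g -> ccontinuous g.
Proof. by case. Qed.

Lemma ccontinuous_opp f : ccontinuous f -> ccontinuous (fun x => f (- x)).
Proof.
move=> [cr ci]; split => x.
- by apply: (@continuous_comp _ _ _ (fun y : G => - y) (fun y => complex.Re (f y)));
    [exact: opp_continuous|exact: cr].
- by apply: (@continuous_comp _ _ _ (fun y : G => - y) (fun y => complex.Im (f y)));
    [exact: opp_continuous|exact: ci].
Qed.

(** After exchanging the integrals, x is translated by y and the character splits as g(-x) = g(-y)
    g(-(x - y)). *)
Lemma fourier_conv f h (g : G -> R[i]) : L1 mu f -> ccontinuous h -> character g ->
  fourier mu (conv mu f h) g = fourier mu f g * fourier mu h g.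
Proof.
move=> f1 ch chg.
have cgN := ccontinuous_opp (character_ccontinuous chg).
have gM : forall x, cabs (g (- x)) <= 1 by move=> x; case: chg => _ _ _ ->.
have gN1 := ccontinuous_L1 cgN.
have h1 := ccontinuous_L1 ch.
have hg1 : L1 mu (fun x => h x * g (- x)).
  by apply: (@L1M _ _ mu h (fun y => g (- y)) 1) => //; exact: ccontinuous_measurable.
have fg1 : L1 mu (fun x => f x * g (- x)).
  by apply: (@L1M _ _ mu f (fun y => g (- y)) 1) => //; exact: ccontinuous_measurable.
rewrite /fourier /conv.
transitivity (cintegral mu (fun x => cintegral mu (fun y => g (- x) * (f y * h (x - y))))).
  congr (cintegral mu _); apply/funext => x.
  by rewrite mulrC -cintegralZl//; exact: conv_integrand_L1.
rewrite (@cintegral_kernel_fubini (fun z => z.1 - z.2) _ _ _ _ gN1 f1 ch)/=; last first.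
  exact: sub_continuous.
rewrite -cintegralZr//; congr (cintegral mu _); apply/funext => y.
rewrite -cintegralZl//.
rewrite -(cintegral_comp (addr_preserving Hmu (- y))
  (f := fun x => f y * g (- y) * (h x * g (- x)))); last by case: (L1Z (f y * g (- y)) hg1).
congr (cintegral mu _); apply/funext => x; rewrite /=.
have -> : g (- x) = g (- y) * g (- (x - y)).
  by case: chg => _ _ <- _; rewrite opprB addKr.
by rewrite mulrC mulrACA.
Qed.

End Convolution.

(** * Approximate identities *)

Section ApproximateIdentity.
Variables (R : realType) (G : topologicalZmodType).
Local Notation BG := (borelG G).
Variable mu : {finite_measure set BG -> \bar R}.
Hypotheses (HG : hausdorff_space G) (Hmu : haar_measure mu).
Implicit Types f g h : G -> R[i].

Let cG : compact [set: G]. Proof. exact: haar_compact HG Hmu. Qed.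

Lemma cabs_powR_measurable f (q : R) : cmeasurable f ->
  measurable_fun [set: BG] (fun x : BG => cabs (f x) `^ q).
Proof.
by move=> /cabs_measurable; exact: (@measurableT_comp _ _ _ _ _ _ (@powR R ^~ q)).
Qed.

(** Continuous probability densities; concentration near 0 is stated separately, in
    [kernel_in_nbhs]. *)
Definition is_kernel (e : G -> R) :=
  [/\ continuous e, forall x, 0 <= e x & (\int[mu]_x (e x)%:E = 1)%E].

Definition cfun_of (e : G -> R) : G -> R[i] := fun x => (e x)%:C%C.

Lemma cfun_of_ccontinuous (e : G -> R) : continuous e -> ccontinuous (cfun_of e).
Proof. by move=> ce; split => //= x; exact: cvg_cst. Qed.

Section Kernel.
Variable e : G -> R.
Hypothesis ke : is_kernel e.
Let ce : continuous e. Proof. by case: ke. Qed.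
Let e0 x : 0 <= e x. Proof. by case: ke. Qed.
Let me : measurable_fun [set: BG] (e : BG -> R). Proof. exact: continuous_borel. Qed.
Let meE : measurable_fun [set: BG] (fun x : BG => (e x)%:E).
Proof. exact/measurable_EFinP. Qed.

Let cce : ccontinuous (cfun_of e). Proof. exact: cfun_of_ccontinuous. Qed.

Lemma kernel_integral_sub (x : G) : (\int[mu]_y (e (x - (y : G)))%:E = 1)%E.
Proof.
case: ke => _ _ <-; apply: (mu_preserving_integral (subl_preserving HG Hmu x) meE).
Qed.

Lemma kernel_integral_add (y : G) : (\int[mu]_x (e ((x : G) - y))%:E = 1)%E.
Proof.
case: ke => _ _ <-; apply: (mu_preserving_integral (addr_preserving Hmu (- y)) meE).
Qed.

Let msub (x : G) : measurable_fun [set: BG] (fun y : BG => e (x - (y : G))).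
Proof. by apply: (measurableT_comp me); case: (subl_preserving HG Hmu x). Qed.

Let isub (x : G) : mu.-integrable setT (fun y : BG => (e (x - (y : G)))%:E).
Proof.
apply/integrableP; split; first exact/measurable_EFinP.
under eq_integral do rewrite gee0_abs ?lee_fin//.
by rewrite kernel_integral_sub ltry.
Qed.

Lemma cabs_conv_kernel f (x : G) : L1 mu f ->
  mu.-integrable setT (fun y : BG => (cabs (f y) * e (x - (y : G)))%:E) /\
  cabs (conv mu f (cfun_of e) x) <= \int[mu]_y (cabs (f y) * e (x - (y : G))).
Proof.
move=> f1; have i1 := conv_integrand_L1 HG Hmu x f1 cce.
have E : (fun y : G => cabs (f y * cfun_of e (x - y))) = fun y => cabs (f y) * e (x - y).
  by apply/funext => y; rewrite cabsM cabs_real ger0_norm.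
split; first by have [_] := (L1P mu _).1 i1; rewrite E.
by apply: le_trans (cabs_cintegral i1) _; rewrite E.
Qed.

(* Jensen's inequality for the probability density [e (x - y)], obtained by
   integrating Young's inequality [t c <= t^q / q + (1 - 1/q) m^q] with
   [c = m^(q-1)], where [m] is the mean of [cabs f]. *)
Lemma powR_cabs_conv_kernel f (x : G) (q : R) : L1 mu f -> 1 <= q ->
  ((cabs (conv mu f (cfun_of e) x) `^ q)%:E <=
   \int[mu]_y (cabs (f y) `^ q * e (x - (y : G)))%:E)%E.
Proof.
move=> f1 q1; have [mi cm] := cabs_conv_kernel x f1.
set m := Rintegral _ _ _ in cm.
have q0 : 0 < q by exact: lt_le_trans q1.
have m0 : 0 <= m by exact: le_trans (cabs_ge0 _) cm.
apply: (@le_trans _ _ (m `^ q)%:E).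
  by rewrite lee_fin ge0_ler_powR ?nnegrE ?cabs_ge0// ltW.
(* The conjugate exponent q / (q - 1) requires q > 1, so q = 1 is treated apart. *)
move: q1; rewrite le_eqVlt => /predU1P[<-|q1].
  rewrite powRr1// fineK; last exact: integrable_fin_num.
  by under [leRHS]eq_integral do rewrite powRr1 ?cabs_ge0//.
have mfq : measurable_fun [set: BG] (fun y : BG => cabs (f y) `^ q).
  by apply: cabs_powR_measurable; case: f1.
have mfqe : measurable_fun [set: BG] (fun y : BG => (cabs (f y) `^ q * e (x - (y : G)))%:E).
  by apply/measurable_EFinP; exact: measurable_funM.
have [->|Jfin] := eqVneq (\int[mu]_y (cabs (f y) `^ q * e (x - (y : G)))%:E)%E +oo%E.
  exact: leey.
have Ji : mu.-integrable setT (fun y : BG => (cabs (f y) `^ q * e (x - (y : G)))%:E).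
  apply/integrableP; split => //.
  under eq_integral do rewrite gee0_abs ?lee_fin ?mulr_ge0 ?powR_ge0//.
  by rewrite ltey.
rewrite -[leRHS]fineK; last exact: integrable_fin_num.
rewrite lee_fin.
set c := m `^ (q - 1).
have qB0 : 0 < q - 1 by rewrite subr_gt0.
have cq : c `^ (q / (q - 1)) = m `^ q.
  by rewrite /c -powRrM mulrCA divff ?mulr1// gt_eqF.
have qV : q^-1 + (q / (q - 1))^-1 = 1.
  by rewrite invf_div mulrBl mul1r divff ?gt_eqF// addrC subrK.
have pw (y : BG) : c * (cabs (f y) * e (x - (y : G))) <=
   q^-1 * (cabs (f y) `^ q * e (x - (y : G))) + (1 - q^-1) * m `^ q * e (x - (y : G)).
  have := conjugate_powR (cabs_ge0 (f y)) (powR_ge0 m (q - 1)) q0 (divr_gt0 q0 qB0) qV.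
  rewrite -/c cq (_ : (q / (q - 1))^-1 = 1 - q^-1); last by apply/eqP; rewrite eq_sym subr_eq addrC qV.
  move=> H; rewrite !mulrA -mulrDl ler_wpM2r// (mulrC c) (le_trans H)//.
  by rewrite (mulrC q^-1) (mulrC (1 - q^-1)).
have i1 := integrableZl measurableT c mi.
have i2 := integrableZl measurableT q^-1 Ji.
have i3 := integrableZl measurableT ((1 - q^-1) * m `^ q) (isub x).
have i23 := integrableD measurableT i2 i3.
have := le_Rintegral measurableT i1 i23 (fun y _ => pw y).
rewrite (RintegralZl c measurableT mi) (RintegralD measurableT i2 i3).
rewrite (RintegralZl q^-1 measurableT Ji).
rewrite (RintegralZl ((1 - q^-1) * m `^ q) measurableT (isub x)).
have -> : \int[mu]_y (e (x - (y : G))) = 1 by rewrite /Rintegral kernel_integral_sub.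
rewrite mulr1 -/m.
(* With J the right-hand integral, what remains is m^q <= J / q + (1 - 1/q) m^q, that is m^q <=
   J. *)
have -> : c * m = m `^ q by rewrite mulrC /c mulr_powRB1.
rewrite mulrBl mul1r addrCA -lerBlDl subrr subr_ge0.
by rewrite ler_pM2l// invr_gt0.
Qed.

(** Integrate the pointwise Jensen bound over x and exchange the integrals by Tonelli; e(x - y) has
    mass 1 in x. *)
Lemma conv_kernel_powR f (q : R) : L1 mu f -> 1 <= q ->
  (\int[mu]_x (cabs (conv mu f (cfun_of e) x) `^ q)%:E <=
   \int[mu]_x (cabs (f x) `^ q)%:E)%E.
Proof.
move=> f1 q1.
have mfq : measurable_fun [set: BG] (fun y : BG => cabs (f y) `^ q).
  by apply: cabs_powR_measurable; case: f1.
have mk : measurable_fun [set: BG * BG]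
    (fun z : BG * BG => (cabs (f z.2) `^ q * e ((z.1 : G) - z.2))%:E).
  apply/measurable_EFinP; apply: measurable_funM.
    exact: (measurableT_comp mfq measurable_snd).
  apply: (continuous_prod_measurable cG (k := fun z : G * G => e (z.1 - z.2))) => z.
  by apply: continuous_comp; [exact: sub_continuous|exact: ce].
have k0 (z : BG * BG) : (0 <= (cabs (f z.2) `^ q * e ((z.1 : G) - z.2))%:E)%E.
  by rewrite lee_fin mulr_ge0// powR_ge0.
apply: (@le_trans _ _ (\int[mu]_x \int[mu]_y (cabs (f y) `^ q * e ((x : G) - y))%:E)%E).
  apply: ge0_le_integral => //.
  - by move=> x _; rewrite lee_fin powR_ge0.
  - apply/measurable_EFinP; apply: cabs_powR_measurable.
    exact/ccontinuous_measurable/conv_ccontinuous.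
  - exact: (measurable_fun_fubini_tonelli_F _ mk k0).
  - by move=> x _; exact: powR_cabs_conv_kernel.
rewrite (fubini_tonelli _ mk k0) /=.
apply: ge0_le_integral => //.
- by move=> y _; apply: integral_ge0 => x _; exact: (k0 (x, y)).
- exact: (measurable_fun_fubini_tonelli_G _ mk k0).
- exact/measurable_EFinP.
- move=> y _; under eq_integral do rewrite EFinM.
  rewrite ge0_integralZl//.
  + by rewrite kernel_integral_add mule1.
  + apply/measurable_EFinP; apply: (measurableT_comp me).
    by case: (addr_preserving Hmu (- (y : G))).
  + by move=> x _; rewrite lee_fin.
  + by rewrite lee_fin powR_ge0.
Qed.

(** As e(x - y) has mass 1 in y, g - g * e at x is the average of g(x) - g(y), and only points with
    x - y in U contribute. *)
Lemma conv_kernel_near g (U : set G) (d : R) : ccontinuous g ->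
  (forall x, ~ U x -> e x = 0) ->
  (forall u x, U u -> cabs (g (x + u) - g x) <= d) ->
  forall x, cabs (g x - conv mu g (cfun_of e) x) <= d.
Proof.
move=> cg eU gU x; have g1 := ccontinuous_L1 HG Hmu cg.
have i1 := conv_integrand_L1 HG Hmu x g1 cce.
have s1 : L1 mu (fun y => cfun_of e (x - y)).
  apply: (L1_comp (f := cfun_of e) (subl_preserving HG Hmu x)).
  by have := ccontinuous_L1 HG Hmu cce.
have -> : g x = cintegral mu (fun y => g x * cfun_of e (x - y)).
  rewrite cintegralZl// [X in _ * X](_ : _ = 1) ?mulr1//.
  rewrite /cintegral /cfun_of /= {1}/Rintegral kernel_integral_sub /=.
  by rewrite /Rintegral integral0.
have i2 := L1Z (g x) s1.
rewrite /conv -cintegralB//; apply: le_trans (cabs_cintegral (L1B i2 i1)) _.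
apply: (@le_trans _ _ (\int[mu]_y (d * e (x - (y : G))))).
  apply: le_Rintegral => //.
  - by have [] := (L1P mu _).1 (L1B i2 i1).
  - exact: (integrableZl _ _ (isub x)).
  - move=> y _ /=; rewrite -mulrBl cabsM cabs_real ger0_norm//.
    have [Uxy|nU] := pselect (U (x - y)); last by rewrite eU ?mulr0.
    by rewrite ler_wpM2r//; have := gU _ y Uxy; rewrite (addrC y) subrK.
rewrite RintegralZl//; last exact: isub.
by rewrite /Rintegral kernel_integral_sub mulr1.
Qed.

End Kernel.

(** Normalise a Urysohn function equal to 1 at 0 and vanishing off U. Its integral is positive
    because it exceeds 1/2 on a nonempty open set, which has positive measure. *)
Lemma kernel_in_nbhs (U : set G) : nbhs (0 : G) U ->
  exists2 e : G -> R, is_kernel e & forall x, ~ U x -> e x = 0.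
Proof.
move=> U0; have oU : open (interior U) by exact: open_interior.
have c0 : closed [set (0 : G)] by apply: compact_closed => //; exact: compact_set1.
have s0 : [set (0 : G)] `<=` interior U by move=> _ ->.
have [f [cf f01 f1 f0]] := urysohn_G HG Hmu c0 oU s0.
have mf := continuous_borel cf.
have fge0 x : 0 <= f x by have /andP[] := f01 x.
have fi : mu.-integrable setT (EFin \o (f : BG -> R)).
  apply: (le_integrable _ _ _ (finite_measure_integrable_cst mu 1 measurableT)) => //.
    exact/measurable_EFinP.
  by move=> x _ /=; rewrite lee_fin normr1 ger0_norm//; have /andP[] := f01 x.
pose I := \int[mu]_x (f (x : G)).
have IE : (\int[mu]_x (f (x : G))%:E = I%:E)%E by rewrite fineK//; exact: integrable_fin_num.
have I0 : 0 < I.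
  pose W := [set x : G | 2^-1 < f x].
  have oW : open W.
    rewrite (_ : W = f @^-1` [set x | x > 2^-1]) //.
    by apply: open_comp => // *; exact: cf.
  have W0 : W 0 by rewrite /W /= f1// invf_lt1// ltr1n.
  have mW := open_borel oW.
  have muW := haar_open_gt0 HG Hmu oW W0.
  rewrite -lte_fin -IE; apply: (@lt_le_trans _ _ (\int[mu]_x (2^-1 * \1_(W : set BG) x)%:E)%E).
    under eq_integral do rewrite EFinM.
    rewrite ge0_integralZl//; last exact/measurable_EFinP/measurable_indic.
    by rewrite integral_indic// setIT mule_gt0// lte_fin invr_gt0.
  apply: ge0_le_integral => //.
  - by apply/measurable_EFinP; apply: measurable_funM => //; exact: measurable_indic.
  - exact/measurable_EFinP.
  - move=> x _; rewrite lee_fin indicE; have [xW|_] := boolP (x \in _).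
      by rewrite mulr1 ltW//; exact: set_mem xW.
    by rewrite mulr0.
exists (fun x => I^-1 * f x); last first.
  by move=> x nU; rewrite f0 ?mulr0// => /interior_subset.
split.
- by move=> x; apply: (@continuousM R G (fun=> I^-1) f); [exact: cvg_cst|exact: cf].
- by move=> x; rewrite mulr_ge0// invr_ge0 ltW.
- under eq_integral do rewrite EFinM.
  rewrite ge0_integralZl//; [|exact/measurable_EFinP|by move=> x _; rewrite lee_fin|
    by rewrite lee_fin invr_ge0 ltW].
  by rewrite IE -EFinM mulVf// gt_eqF.
Qed.

Lemma approximate_identity g (d : R) : ccontinuous g -> 0 < d ->
  exists2 e, is_kernel e & forall x, cabs (g x - conv mu g (cfun_of e) x) <= d.
Proof.
move=> cg d0; have [e ke eU] := kernel_in_nbhs (ccontinuous_uniform HG Hmu cg d0).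
exists e => //; apply: (conv_kernel_near ke cg eU) => u x Uu; exact: ltW (Uu x).
Qed.

End ApproximateIdentity.

(** * Convolution norms *)

Section Norms.
Variables (R : realType) (G : topologicalZmodType).
Local Notation BG := (borelG G).
Variable mu : {finite_measure set BG -> \bar R}.
Implicit Types f g h : G -> R[i].

(* The four properties of a norm that the smoothing argument needs; the last
   one says that convolution with a probability density is a contraction. *)
Definition convolution_norm (N : (G -> R[i]) -> \bar R) :=
  [/\ forall f g, cmeasurable f -> cmeasurable g -> (N (f \+ g)%R <= N f + N g)%E,
      forall f g, N (f \- g) = N (g \- f),
      exists2 C : R, 0 < C & forall (M : R) f, 0 <= M -> cmeasurable f ->
        (forall x, cabs (f x) <= M) -> (N f <= (C * M)%:E)%E &
      forall e f, is_kernel mu e -> L1 mu f -> (N (conv mu f (cfun_of e)) <= N f)%E].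

Lemma convolution_norm_triangle (N : (G -> R[i]) -> \bar R) f g h :
  convolution_norm N -> cmeasurable f -> cmeasurable g -> cmeasurable h ->
  (N (f \- h)%R <= N (f \- g)%R + N (g \- h)%R)%E.
Proof.
move=> [tri _ _ _] mf mg mh; rewrite (_ : f \- h = (f \- g) \+ (g \- h)).
  by apply: tri; exact: cmeasurableB.
by apply/funext => x /=; rewrite addrA subrK.
Qed.

(** Written as in [grand_norm], so that each member of that supremum is a weight times an
    [Lqnorm]. *)
Definition Lqnorm (q : R) f := ((\int[mu]_x (cabs (f x) `^ q)%:E) `^ (1 / q))%E.

Let int_ge0 (q : R) f : (0 <= \int[mu]_x (cabs (f x) `^ q)%:E)%E.
Proof. by apply: integral_ge0 => x _; rewrite lee_fin powR_ge0. Qed.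

Let poweR_mono (q : R) (a b : \bar R) : 1 <= q -> (0 <= a)%E -> (a <= b)%E ->
  (a `^ (1 / q) <= b `^ (1 / q))%E.
Proof.
move=> q1 a0 ab; apply: gt0_ler_poweR => //.
- by rewrite divr_ge0// (le_trans ler01).
- by rewrite in_itv /= a0 leey.
- by rewrite in_itv /= (le_trans a0) ?leey.
Qed.

Lemma Lqnorm_ge0 q f : (0 <= Lqnorm q f)%E.
Proof. exact: poweR_ge0. Qed.

(** Minkowski's inequality for the moduli, combined with |f + g| <= |f| + |g|. *)
Lemma Lqnorm_triangle q f g : 1 <= q -> cmeasurable f -> cmeasurable g ->
  (Lqnorm q (f \+ g)%R <= Lqnorm q f + Lqnorm q g)%E.
Proof.
move=> q1 mf mg.
have maf := cabs_measurable mf; have mag := cabs_measurable mg.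
have E (u : BG -> R) : (forall x, 0 <= u x) ->
    ((\int[mu]_x (u x `^ q)%:E) `^ (1 / q) = Lnorm mu q%:E (EFin \o u))%E.
  move=> u0; rewrite unlock div1r; congr (_ `^ _)%E; apply: eq_integral => x _.
  by rewrite /= ger0_norm.
have := @minkowski_EFin _ _ _ mu (fun x : BG => cabs (f x)) (fun x : BG => cabs (g x)) q maf mag q1.
rewrite -!E; [|by move=> x; rewrite ?addr_ge0 ?cabs_ge0..].
apply: le_trans; apply: poweR_mono => //.
apply: ge0_le_integral => //.
- by move=> x _; rewrite lee_fin powR_ge0.
- by apply/measurable_EFinP; apply: cabs_powR_measurable; exact: cmeasurableD.
- apply/measurable_EFinP; apply: (@measurableT_comp _ _ _ _ _ _ (@powR R ^~ q)) => //.
  exact: measurable_funD.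
- move=> x _; rewrite lee_fin ge0_ler_powR ?nnegrE ?addr_ge0 ?cabs_ge0//.
    exact: le_trans ler01 q1.
  exact: cabsD.
Qed.

Lemma Lqnorm_distC q f g : Lqnorm q (f \- g) = Lqnorm q (g \- f).
Proof.
rewrite /Lqnorm (_ : (fun x : BG => _) = fun x : BG => (cabs ((g \- f) x) `^ q)%:E)//.
by apply/funext => x; rewrite /= cabs_distC.
Qed.

(** The bound is independent of q, since the total mass to the power 1/q is at most its maximum with
    1. *)
Lemma Lqnorm_bounded q f (M : R) : 1 <= q -> 0 <= M -> cmeasurable f ->
  (forall x, cabs (f x) <= M) ->
  (Lqnorm q f <= (M * Num.max 1 (fine (mu setT)))%:E)%E.
Proof.
move=> q1 M0 mf fM; have q0 : 0 < q by exact: lt_le_trans q1.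
have mTf := fin_num_measure mu setT measurableT.
have m0 : 0 <= fine (mu setT) by rewrite fine_ge0.
apply: (@le_trans _ _ (((M `^ q * fine (mu setT))%:E) `^ (1 / q))%E).
  apply: poweR_mono => //.
  rewrite EFinM fineK// -(integral_cst mu measurableT (M `^ q)%:E).
  apply: ge0_le_integral => //.
  - by move=> x _; rewrite lee_fin powR_ge0.
  - by apply/measurable_EFinP; exact: cabs_powR_measurable.
  - move=> x _; rewrite lee_fin ge0_ler_powR ?nnegrE ?cabs_ge0//.
    exact: ltW.
rewrite poweR_EFin lee_fin powRM ?powR_ge0// -powRrM mulrC div1r.
rewrite divff ?gt_eqF// powRr1// mulrC ler_wpM2l//.
have [mu1|mu1] := leP (fine (mu setT)) 1.
  apply: (@le_trans _ _ (1 `^ q^-1)); last by rewrite powR1.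
  by rewrite ge0_ler_powR ?nnegrE ?invr_ge0// ltW.
by rewrite ler1_powR// ?invf_le1// ltW.
Qed.

Hypotheses (HG : hausdorff_space G) (Hmu : haar_measure mu).

Lemma Lqnorm_conv_kernel q e f : 1 <= q -> is_kernel mu e -> L1 mu f ->
  (Lqnorm q (conv mu f (cfun_of e)) <= Lqnorm q f)%E.
Proof.
move=> q1 ke f1; apply: (poweR_mono q1 (int_ge0 q _)).
exact: (conv_kernel_powR HG Hmu ke f1 q1).
Qed.

(** * The grand Lebesgue norm *)

Variables p theta : R.
Hypotheses (p1 : 1 < p) (theta0 : 0 <= theta).
Local Notation N := (grand_norm mu p theta).

Let grand_le f (b : \bar R) : (forall e, 0 < e -> e <= p - 1 ->
    ((e `^ (theta / (p - e)))%:E * Lqnorm (p - e) f <= b)%E) -> (N f <= b)%E.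
Proof.
move=> H; apply: ge_ereal_sup => _ [e /= + <-].
by rewrite in_itv /= => /andP[e0 e1]; exact: H.
Qed.

Let le_grand f e : 0 < e -> e <= p - 1 ->
  ((e `^ (theta / (p - e)))%:E * Lqnorm (p - e) f <= N f)%E.
Proof.
move=> e0 e1; apply: ereal_sup_ubound; exists e => //=.
by rewrite in_itv /= e0.
Qed.

Let q_ge1 e : e <= p - 1 -> 1 <= p - e.
Proof. by rewrite lerBrDr -lerBrDl. Qed.

(** The left side is the member eps = p - 1 of the supremum, whose exponent p - eps is 1. *)
Lemma L1norm_le_grand_norm f : (((p - 1) `^ theta)%:E * L1norm mu f <= N f)%E.
Proof.
have pB0 : 0 < p - 1 by rewrite subr_gt0.
have := le_grand f pB0 (lexx _).
rewrite subKr divr1 /Lqnorm divr1 poweRe1//.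
by under eq_integral do rewrite powRr1 ?cabs_ge0//.
Qed.

(** Each property is checked on the members of the supremum, with constants uniform in eps. *)
Lemma grand_norm_convolution : convolution_norm N.
Proof.
split.
- move=> f g mf mg; apply: grand_le => e e0 e1.
  apply: (@le_trans _ _ ((e `^ (theta / (p - e)))%:E * (Lqnorm (p - e) f + Lqnorm (p - e) g))%E).
    by rewrite lee_wpmul2l ?lee_fin ?powR_ge0// Lqnorm_triangle// q_ge1.
  by rewrite ge0_muleDr ?Lqnorm_ge0// leeD// le_grand.
- have le f g : (N (f \- g)%R <= N (g \- f)%R)%E.
    apply: grand_le => e e0 e1.
    by rewrite (Lqnorm_distC _ f g) le_grand.
  by move=> f g; apply/le_anti/andP; split; exact: le.
(* The first factor bounds every weight, because e <= p - 1 and theta / (p - e) <= theta; the second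
   comes from [Lqnorm_bounded]. *)
- exists (Num.max 1 (p - 1) `^ theta * Num.max 1 (fine (mu setT))).
    by rewrite mulr_gt0 ?powR_gt0// lt_max ltr01.
  move=> M f M0 mf fM; apply: grand_le => e e0 e1.
  have q1 := q_ge1 e1; have q0 : 0 < p - e by exact: lt_le_trans q1.
  rewrite -mulrA EFinM lee_pmul ?Lqnorm_ge0 ?lee_fin ?powR_ge0//.
    apply: (@le_trans _ _ (Num.max 1 (p - 1) `^ (theta / (p - e)))).
      rewrite ge0_ler_powR ?nnegrE ?le_max ?ler01 ?e1 ?orbT ?(ltW e0)//.
      by rewrite divr_ge0// ltW.
    by rewrite ler_powR ?le_max ?lexx// ler_pdivrMr// ler_peMr.
  by rewrite mulrC; exact: Lqnorm_bounded.
- move=> e' f ke f1; apply: grand_le => e e0 e1.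
  apply: le_trans (le_grand f e0 e1).
  apply: lee_wpmul2l; first by rewrite lee_fin powR_ge0.
  exact: Lqnorm_conv_kernel (q_ge1 e1) ke f1.
Qed.

End Norms.

(** * The L^1 norm as the case q = 1 *)

Section L1Norm.
Variables (R : realType) (G : topologicalZmodType).
Local Notation BG := (borelG G).
Variable mu : {finite_measure set BG -> \bar R}.
Hypotheses (HG : hausdorff_space G) (Hmu : haar_measure mu).

Lemma L1norm_Lqnorm : L1norm mu = Lqnorm mu 1.
Proof.
apply/funext => f; rewrite /Lqnorm divr1 poweRe1.
  by apply: eq_integral => x _; rewrite powRr1 ?cabs_ge0.
by apply: integral_ge0 => x _; rewrite lee_fin powR_ge0.
Qed.

Lemma L1norm_convolution : convolution_norm mu (L1norm mu).
Proof.
split.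
- by move=> f g mf mg; rewrite L1norm_Lqnorm Lqnorm_triangle.
- by move=> f g; rewrite L1norm_Lqnorm Lqnorm_distC.
- exists (Num.max 1 (fine (mu setT))); first by rewrite lt_max ltr01.
  by move=> M f M0 mf fM; rewrite L1norm_Lqnorm mulrC Lqnorm_bounded.
- move=> e f ke f1; rewrite L1norm_Lqnorm.
  exact: (Lqnorm_conv_kernel HG Hmu (lexx 1) ke f1).
Qed.

End L1Norm.

(** * Ditkin sets *)

(** The finite upper bounds exclude +oo on the left, and a summand -oo makes the whole sum -oo. *)
Lemma lte_leD_EFin (R : realDomainType) (a b : \bar R) (x y : R) :
  (a < x%:E -> b <= y%:E -> a + b < (x + y)%:E)%E.
Proof.
move: a b => [a| |] [b| |]; rewrite ?leye_eq// -?EFinD ?lte_fin ?lee_fin ?ltNyr//.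
exact: ltr_leD.
Qed.

Section Ditkin.
Variables (R : realType) (G : topologicalZmodType).
Local Notation BG := (borelG G).
Variable mu : {finite_measure set BG -> \bar R}.
Hypotheses (HG : hausdorff_space G) (Hmu : haar_measure mu).
Implicit Types f g h : G -> R[i].

(** Write f - f * e = (f - g) + (g - g * e) + (g - f) * e with g continuous. The middle term is
    uniformly small and the last is controlled by contraction. *)
Lemma conv_kernel_approx (N : (G -> R[i]) -> \bar R) f : convolution_norm mu N ->
  L1 mu f ->
  (forall d : R, 0 < d -> exists2 g, ccontinuous g & (N (f \- g)%R < d%:E)%E) ->
  forall d : R, 0 < d ->
  exists2 e, is_kernel mu e & (N (f \- conv mu f (cfun_of e))%R < d%:E)%E.
Proof.
move=> cN f1 approx d d0; have [_ Nsym [C C0 Nbd] Nconv] := cN.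
have d30 : 0 < d / 3%:R by rewrite divr_gt0.
have [g cg fg] := approx _ d30.
(* A uniform error of d / 3 / C costs at most d / 3 in the norm [N]. *)
have [e ke ge] := approximate_identity HG Hmu cg (divr_gt0 d30 C0).
have cke : ccontinuous (cfun_of e) by apply: cfun_of_ccontinuous; case: ke.
have g1 := ccontinuous_L1 HG Hmu cg.
have cge := conv_ccontinuous HG Hmu g1 cke.
have cfe := conv_ccontinuous HG Hmu f1 cke.
have mf := f1.1; have mg := ccontinuous_measurable cg.
have mge := ccontinuous_measurable cge; have mfe := ccontinuous_measurable cfe.
exists e => //.
have t1 : (N (g \- conv mu g (cfun_of e))%R <= (d / 3%:R)%:E)%E.
  have := Nbd (d / 3%:R / C) (g \- conv mu g (cfun_of e)).
  by rewrite (mulrC C) divfK ?gt_eqF//; apply => //; [rewrite ltW ?divr_gt0|exact: cmeasurableB].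
have t2 : (N (conv mu g (cfun_of e) \- conv mu f (cfun_of e))%R <= (d / 3%:R)%:E)%E.
  rewrite -(convBl HG Hmu g1 f1 cke); apply: le_trans (Nconv _ _ ke (L1B g1 f1)) _.
  by rewrite Nsym ltW.
apply: le_lt_trans (convolution_norm_triangle cN mf mg mfe) _.
have -> : d = d / 3%:R + (d / 3%:R + d / 3%:R) by field.
apply: lte_leD_EFin => //.
apply: le_trans (convolution_norm_triangle cN mg mge mfe) _.
by rewrite EFinD leeD.
Qed.

Lemma L1_approx f : L1 mu f -> forall d : R, 0 < d ->
  exists2 g, ccontinuous g & (L1norm mu (f \- g)%R < d%:E)%E.
Proof.
move=> f1 d d0; have d20 : 0 < d / 2 by rewrite divr_gt0.
have [[mr mi] _] := f1.
have [_ /(_ _ d20)[u cu hu]] := continuous_approximable_integrable HG Hmu (L1_Re f1).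
have [_ /(_ _ d20)[v cv hv]] := continuous_approximable_integrable HG Hmu (L1_Im f1).
pose g (x : G) : R[i] := Complex (u x) (v x).
have cg : ccontinuous g by split.
exists g => //; have mg := ccontinuous_measurable cg.
have mu' := continuous_borel cu; have mv := continuous_borel cv.
have m1 : measurable_fun [set: BG] (fun x : BG => `|complex.Re (f x) - u x|%:E).
  by apply/measurable_EFinP; apply: measurableT_comp => //; exact: measurable_funB.
have m2 : measurable_fun [set: BG] (fun x : BG => `|complex.Im (f x) - v x|%:E).
  by apply/measurable_EFinP; apply: measurableT_comp => //; exact: measurable_funB.
apply: (@le_lt_trans _ _ (\int[mu]_x (`|complex.Re (f x) - u x|%:E + `|complex.Im (f x) - v x|%:E))%E).
  apply: ge0_le_integral => //.
  - by move=> x _; rewrite lee_fin cabs_ge0.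
  - apply/measurable_EFinP; apply: cabs_measurable; apply: cmeasurableB => //.
  - exact: emeasurable_funD.
  - move=> x _; rewrite -EFinD lee_fin; apply: le_trans (cabs_le_ReIm _) _.
    by rewrite /g /=; case: (f x).
rewrite ge0_integralD// (splitr d) EFinD; exact: lteD.
Qed.

Variables (p theta : R).
Hypotheses (p1 : 1 < p) (theta0 : 0 <= theta).
Local Notation N := (grand_norm mu p theta).

Let cG : compact [set: G]. Proof. exact: haar_compact HG Hmu. Qed.
Let cN : convolution_norm mu N. Proof. exact: grand_norm_convolution. Qed.

Lemma ccontinuous_Cc g : ccontinuous g -> Cc g.
Proof.
move=> [cr ci]; split => //; split => //.
by apply: (subclosed_compact _ cG) => //; exact: closed_closure.
Qed.

Lemma Cc_ccontinuous g : Cc g -> ccontinuous g.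
Proof. by move=> [cr [ci _]]. Qed.

(** A continuous function is bounded, hence of finite norm, and it serves as its own
    approximation. *)
Lemma ccontinuous_grandLp g : ccontinuous g -> grandLp_closure mu p theta g.
Proof.
move=> cg; have [_ _ [C C0 Nbd] _] := cN.
have [M M0 gM] := ccontinuous_bounded HG Hmu cg.
have mg := ccontinuous_measurable cg.
split; first by split => //; exact: le_lt_trans (Nbd M g M0 mg gM) (ltry _).
move=> d d0; exists g; split; first exact: ccontinuous_Cc.
have gg0 (x : G) : cabs ((g \- g) x) <= 0 by rewrite /= subrr cabs0.
by apply: le_lt_trans (Nbd 0 _ (lexx _) (cmeasurableB mg mg) gg0) _; rewrite mulr0.
Qed.

(** The factor by which [N] dominates [L1norm]. *)
Let K := (p - 1) `^ theta.
Let K0 : 0 < K. Proof. by rewrite powR_gt0// subr_gt0. Qed.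

Lemma L1norm_lt_of_grand_norm f (d : R) : (N f < (K * d)%:E)%E -> (L1norm mu f < d%:E)%E.
Proof.
move=> Nf; have := le_lt_trans (L1norm_le_grand_norm mu theta p1 f) Nf.
by rewrite EFinM lte_pmul2l.
Qed.

Lemma grandLp_L1 f : grandLp_closure mu p theta f -> L1 mu f.
Proof.
move=> [[mf Nf] _]; split => //.
have N0 : (0 <= N f)%E.
  apply: le_trans (L1norm_le_grand_norm mu theta p1 f).
  rewrite mule_ge0// ?lee_fin ?powR_ge0//.
  by apply: integral_ge0 => x _; rewrite lee_fin cabs_ge0.
have fN : N f \is a fin_num by rewrite ge0_fin_numE.
(* The added 1 provides the strict inequality that [L1norm_lt_of_grand_norm] expects. *)
have : (L1norm mu f < (K^-1 * fine (N f) + 1)%:E)%E.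
  apply: L1norm_lt_of_grand_norm.
  rewrite mulrDr mulrA divff ?gt_eqF// mul1r mulr1 EFinD fineK//.
  by rewrite lteDl// lte_fin.
by move=> h; exact: lt_trans h (ltry _).
Qed.

Variable E : set (G -> R[i]).
Hypothesis Edual : E `<=` @dual R G.

Let fourier0 f h g : L1 mu f -> ccontinuous h -> character g ->
  fourier mu f g = 0 -> fourier mu (conv mu f h) g = 0.
Proof. by move=> f1 ch cg f0; rewrite fourier_conv// f0 mul0r. Qed.

Lemma ditkin_grand_L1 : ditkin mu (grandLp_closure mu p theta) N E ->
  ditkin mu (L1 mu) (L1norm mu) E.
Proof.
move=> H f f1 fE d d0; have d20 : 0 < d / 2 by rewrite divr_gt0.
have cN1 := L1norm_convolution HG Hmu.
have [e ke fe] := conv_kernel_approx cN1 f1 (L1_approx f1) d20.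
have cke : ccontinuous (cfun_of e) by apply: cfun_of_ccontinuous; case: ke.
set h := conv mu f (cfun_of e) in fe.
have ch : ccontinuous h by exact: conv_ccontinuous.
have hE g : E g -> fourier mu h g = 0.
  by move=> Eg; apply: fourier0 => //; [exact: Edual|exact: fE].
(* Precision K d / 2 in the grand norm gives d / 2 in L^1. *)
have [F [XF [V [Vo EV FV]] hF]] := H h (ccontinuous_grandLp ch) hE _ (mulr_gt0 K0 d20).
have F1 := grandLp_L1 XF.
have ke1 := ccontinuous_L1 HG Hmu cke.
have eF : conv mu (cfun_of e) F = conv mu F (cfun_of e).
  by apply: convC => //; [exact: ccontinuous_measurable|case: F1].
have ceF : ccontinuous (conv mu F (cfun_of e)) by exact: conv_ccontinuous.
exists (conv mu F (cfun_of e)); split; first exact: ccontinuous_L1.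
  exists V; split => // g Vg; apply: fourier0 => //; last exact: FV.
  by case: Vo => + _; apply.
(* f * (F * e) = f * (e * F) = (f * e) * F = h * F. *)
rewrite -eF -(convA HG Hmu f1 cke F1) -/h.
have hF1 : ccontinuous (conv mu h F).
  rewrite (convC HG Hmu (ccontinuous_measurable ch) F1.1); exact: conv_ccontinuous.
apply: le_lt_trans (convolution_norm_triangle cN1 f1.1 (ccontinuous_measurable ch)
  (ccontinuous_measurable hF1)) _.
rewrite (splitr d) EFinD; apply: lteD => //.
exact: L1norm_lt_of_grand_norm.
Qed.

Lemma ditkin_L1_grand : ditkin mu (L1 mu) (L1norm mu) E ->
  ditkin mu (grandLp_closure mu p theta) N E.
Proof.
move=> H f Xf fE d d0; have d30 : 0 < d / 3%:R by rewrite divr_gt0.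
have f1 := grandLp_L1 Xf.
have approx (b : R) : 0 < b -> exists2 g, ccontinuous g & (N (f \- g)%R < b%:E)%E.
  by move=> b0; case: Xf => _ /(_ b b0)[g [/Cc_ccontinuous cg fg]]; exists g.
have [e ke fe] := conv_kernel_approx cN f1 approx d30.
have cke : ccontinuous (cfun_of e) by apply: cfun_of_ccontinuous; case: ke.
set h := conv mu f (cfun_of e) in fe.
have ch : ccontinuous h by exact: conv_ccontinuous.
have h1 := ccontinuous_L1 HG Hmu ch.
have approxh (b : R) : 0 < b -> exists2 g, ccontinuous g & (N (h \- g)%R < b%:E)%E.
  move=> b0; have [_ /(_ b b0)[g [/Cc_ccontinuous cg fg]]] := ccontinuous_grandLp ch.
  by exists g.
have [e' ke' he'] := conv_kernel_approx cN h1 approxh d30.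
have cke' : ccontinuous (cfun_of e') by apply: cfun_of_ccontinuous; case: ke'.
have hE g : E g -> fourier mu h g = 0.
  by move=> Eg; apply: fourier0 => //; [exact: Edual|exact: fE].
have [_ _ [C C0 Nbd] _] := cN.
have [M M0 eM] := ccontinuous_bounded HG Hmu cke'.
have M1 : 0 < M + 1 by rewrite ltr_wpDl.
(* If w has L^1 norm below this value, w * e' is bounded by d / 3 / C, as |e'| <= M, so its grand
   norm is at most d / 3. *)
have b0 : 0 < d / 3%:R / C / (M + 1) by rewrite !divr_gt0.
have [F [F1 [V [Vo EV FV]] hF]] := H h h1 hE _ b0.
have eF : conv mu (cfun_of e) F = conv mu F (cfun_of e).
  by apply: convC => //; [exact: ccontinuous_measurable|case: F1].
set c := conv mu F (cfun_of e) in eF.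
have cc : ccontinuous c by exact: conv_ccontinuous.
have c1 := ccontinuous_L1 HG Hmu cc.
have cF' : ccontinuous (conv mu c (cfun_of e')) by exact: conv_ccontinuous.
exists (conv mu c (cfun_of e')); split; first exact: ccontinuous_grandLp.
  exists V; split => // g Vg; have chg : character g by case: Vo => + _; apply.
  by do 2 apply: fourier0 => //; exact: FV.
have e'1 := ccontinuous_L1 HG Hmu cke'.
(* f * ((F * e) * e') = (f * (e * F)) * e' = (h * F) * e'. *)
rewrite -(convA HG Hmu f1 cc e'1) -eF -(convA HG Hmu f1 cke F1) -/h.
have chF : ccontinuous (conv mu h F).
  rewrite (convC HG Hmu (ccontinuous_measurable ch) F1.1); exact: conv_ccontinuous.
have hF1 := ccontinuous_L1 HG Hmu chF.
have che := conv_ccontinuous HG Hmu h1 cke'.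
have chFe := conv_ccontinuous HG Hmu hF1 cke'.
have mh := ccontinuous_measurable ch; have mhe := ccontinuous_measurable che.
have mhFe := ccontinuous_measurable chFe.
apply: le_lt_trans (convolution_norm_triangle cN f1.1 mh mhFe) _.
have -> : d = d / 3%:R + (d / 3%:R + d / 3%:R) by field.
apply: lte_leD_EFin; first exact: fe.
apply: le_trans (convolution_norm_triangle cN mh mhe mhFe) _.
rewrite EFinD; apply: leeD; first exact: (ltW he').
(* The third term is w * e' with w = h - h * F small in L^1; it is estimated through its
   supremum. *)
rewrite -(convBl HG Hmu h1 hF1 cke').
have w1 := L1B h1 hF1; set w := (h \- conv mu h F)%R in hF w1 *.
have cw := conv_ccontinuous HG Hmu w1 cke'.
have bound x : cabs (conv mu w (cfun_of e') x) <= d / 3%:R / C.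
  apply: le_trans (cabs_cintegral (conv_integrand_L1 HG Hmu x w1 cke')) _.
  have [_ wi] := (L1P mu w).1 w1.
  apply: (@le_trans _ _ (\int[mu]_y (M * cabs (w y)))).
    apply: le_Rintegral => //.
    - by have [] := (L1P mu _).1 (conv_integrand_L1 HG Hmu x w1 cke').
    - exact: (integrableZl _ _ wi).
    - by move=> y _; rewrite cabsM mulrC ler_wpM2r ?cabs_ge0.
  rewrite RintegralZl//.
  move: hF; rewrite (L1norm_fine w1) lte_fin ltr_pdivlMr// => /ltW; apply: le_trans.
  by rewrite mulrC ler_wpM2l ?lerDl// Rintegral_ge0// => y _; exact: cabs_ge0.
have := Nbd (d / 3%:R / C) _ (ltW (divr_gt0 d30 C0)) (ccontinuous_measurable cw) bound.
by rewrite (mulrC C) divfK ?gt_eqF.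
Qed.

End Ditkin.

(** * Measures of finite total mass as finite measures *)

Section FiniteCopy.
Context d (T : measurableType d) (R : realType) (mu : {measure set T -> \bar R}).
Hypothesis fin : fin_num_fun mu.

(** A synonym of [mu] indexed by the finiteness proof, to which the finite-measure structure is
    attached. *)
Definition finite_copy of fin_num_fun mu : set T -> \bar R := mu.
HB.instance Definition _ := Measure.copy (finite_copy fin) mu.
HB.instance Definition _ := Measure_isFinite.Build d T R (finite_copy fin) fin.

End FiniteCopy.

Theorem theorem3p3 (R : realType) (G : topologicalZmodType)
    (mu : {measure set (borelG G) -> \bar R})
    (HG : hausdorff_space G) (HGlc : locally_compact [set: G])
    (Hmu : haar_measure mu) (Hfin : (mu setT < +oo)%E)
    (p theta : R) (Hp1 : 1 < p) (Htheta : 0 <= theta)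
    (E : set (G -> R[i])) (HE : dual_closed E) :
  ditkin mu (grandLp_closure mu p theta) (grand_norm mu p theta) E <->
  ditkin mu (L1 mu) (L1norm mu) E.
Proof.
have fin : fin_num_fun mu.
  move=> A mA; rewrite ge0_fin_numE//; apply: le_lt_trans Hfin.
  by apply: le_measure; rewrite ?inE.
pose fmu : {finite_measure set (borelG G) -> \bar R} := finite_copy fin.
(* [fmu] unfolds to [mu], so the hypotheses and both Ditkin properties transfer by conversion. *)
have Hfmu : haar_measure fmu by exact: Hmu.
have [Ed _] := HE.
split.
- exact: (@ditkin_grand_L1 _ _ fmu HG Hfmu p theta Hp1 Htheta E Ed).
- exact: (@ditkin_L1_grand _ _ fmu HG Hfmu p theta Hp1 Htheta E Ed).
Qed.
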